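(* Let $\mathfrak X_1,\dots,\mathfrak X_N\in\mathfrak{GM}$ and $\rho\in\Delta_{N-1}$ be fixed. Let $(\mathfrak Y_n)_{n\in\mathbb N}\subset\mathfrak{GM}$ be a sequence with $\mathfrak Y_{n+1}\in\widetilde{\mathrm{TB}}_\rho(\mathfrak Y_n)$ for all $n$. Then every subsequence of $(\mathfrak Y_n)_{n\in\mathbb N}$ contains a convergent subsequence $\mathfrak Y_{n_\ell}\to\mathfrak Y\in\mathfrak{GM}$ (with respect to the metric $\mathrm{GW}$) whose limit satisfies $\mathfrak Y\in\widetilde{\mathrm{TB}}_\rho(\mathfrak Y)$.
   Context: A gauged measure space (gm-space) is a triple $\mathbb X=(X,g,\xi)$ where $X$ is a Polish space, $\xi$ is a Borel probability measure on $X$, and $g$ is a gauge, i.e. $g\in L^2_{\mathrm{sym}}(X\times X,\xi\otimes\xi)$ (symmetric, real-valued, square-integrable). For gm-spaces $\mathbb X=(X,g,\xi)$, $\mathbb Y=(Y,h,\upsilon)$, $\Pi(\mathbb X,\mathbb Y)$ is the set of Borel probability measures on $X\times Y$ with marginals $\xi,\upsilon$; $F_{\mathrm{GW}}^{\mathbb X,\mathbb Y}(\pi):=\bigl(\iint |g(x,x')-h(y,y')|^2\,d\pi(x,y)\,d\pi(x',y')\bigr)^{1/2}$; $\mathrm{GW}(\mathbb X,\mathbb Y):=\inf_{\pi\in\Pi(\mathbb X,\mathbb Y)}F_{\mathrm{GW}}^{\mathbb X,\mathbb Y}(\pi)$ (the infimum is attained), and $\Pi_{\mathrm o}(\mathbb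 X,\mathbb Y)$ is the set of minimizers. Spaces are homomorphic, $\mathbb X\simeq\mathbb Y$, if $\mathrm{GW}(\mathbb X,\mathbb Y)=0$; $\llbracket\mathbb X\rrbracket$ denotes the equivalence class and $\mathfrak{GM}$ the set of all classes, which is a metric space under $\mathrm{GW}(\llbracket\mathbb X\rrbracket,\llbracket\mathbb Y\rrbracket):=\mathrm{GW}(\mathbb X,\mathbb Y)$. $\Delta_{N-1}:=\{\rho\in[0,1]^N:\sum_i\rho_i=1\}$. Let $\mathbb X_i=(X_i,g_i,\xi_i)\in\mathfrak X_i$ be representatives, $X_\times:=X_1\times\cdots\times X_N$ and $m_\rho(x_\times,x_\times'):=\sum_{i=1}^N\rho_i g_i(x_i,x_i')$. For $\mathbb Y=(Y,h,\upsilon)$ and $\pi_i\in\Pi(\mathbb Y,\mathbb X_i)$ let $\Gamma_{\mathbb Y}(\pi_1,\dots,\pi_N)$ be the set of Borel probability measures $\gamma$ on $Y\times X_\times$ with $(P_{Y\times X_i})_\#\gamma=\pi_i$ for all $i$ (gluings), and $\mathrm M_{\mathbb Y}(\pi_1,\dots,\pi_N):=\{(P_{X_\times})_\#\gamma:\gamma\in\Gamma_{\mathbb Y}(\pi_1,\dots,\pi_N)\}$ (meltings); $P_\bullet$ is the projection onto the indicated components and $\#$ the push-forward. For $\mathbb Y\in\mathfrak Y$ put $$\mathrm M^{\mathrm o}_{\mathfrak Y}(\mathbb X_1,\dots,\mathbb X_N):=\{\mu\in\mathrm M_{\mathbb Y}(\pi_1,\dots,\pi_N):\pi_i\in\Pi_{\mathrm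 o}(\mathbb Y,\mathbb X_i),\ i=1,\dots,N\},$$ $$\widetilde{\mathrm{TB}}_\rho(\mathfrak Y):=\{\llbracket(X_\times,m_\rho,\mu)\rrbracket:\mu\in\mathrm M^{\mathrm o}_{\mathfrak Y}(\mathbb X_1,\dots,\mathbb X_N)\}.$$ These sets do not depend on the representative $\mathbb Y\in\mathfrak Y$, and $\widetilde{\mathrm{TB}}_\rho(\mathfrak Y)$ does not depend on the representatives $\mathbb X_i\in\mathfrak X_i$. *)

(* Defs.v *)
From HB Require Import structures.
From mathcomp Require Import all_boot all_order all_algebra.
From mathcomp Require Import all_classical all_reals all_analysis measurable_realfun.

Set Implicit Arguments.
Unset Strict Implicit.
Unset Printing Implicit Defensive.

Import Order.TTheory GRing.Theory Num.Theory.
Import numFieldNormedType.Exports.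

Local Open Scope classical_set_scope.
Local Open Scope ring_scope.

Definition is_metric (R : realType) (T : Type) (d : T -> T -> R) : Prop :=
  [/\ forall x y, d x y = 0 <-> x = y,
      forall x y, d x y = d y x &
      forall x y z, d x z <= d x y + d y z].

Definition induces_topology (R : realType) (T : topologicalType)
    (d : T -> T -> R) : Prop :=
  forall (x : T) (A : set T),
    nbhs x A <-> exists2 e : R, 0 < e & [set y | d x y < e] `<=` A.

Definition complete_metric (R : realType) (T : topologicalType)
    (d : T -> T -> R) : Prop :=
  forall u : nat -> T,
    (forall e : R, 0 < e -> exists n0 : nat, forall m n : nat,
       (n0 <= m)%N -> (n0 <= n)%N -> d (u m) (u n) < e) ->
    exists l : T, u @ \oo --> l.

Definition separable (T : topologicalType) : Prop :=
  exists2 S : set T, countable S & dense S.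

(* Only the topology is part of a Polish space: the metric is existential. *)
Definition polish (R : realType) (T : topologicalType) : Prop :=
  separable T /\
  exists d : T -> T -> R,
    [/\ is_metric d, induces_topology d & complete_metric d].

(* [measurableType] is pointed, whence [ptopologicalType]. On [borel X * borel Y]
   the canonical measurable sets are the product sigma-algebra, which is the
   Borel sigma-algebra of [X * Y] because Polish spaces are second countable. *)
Definition borel (T : ptopologicalType) := g_sigma_algebraType (@open T).

HB.instance Definition _ (I : Type) (T : I -> ptopologicalType) :=
  Pointed.on (prod_topology T).

(* [f # mu = nu]; measures are functions on all subsets, so equality is only
   meaningful on measurable ones. *)
Definition is_pushforward (R : realType) (d1 d2 : measure_display)
    (T1 : measurableType d1) (T2 : measurableType d2)
    (mu : set T1 -> \bar R) (f : T1 -> T2) (nu : set T2 -> \bar R) : Prop :=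
  forall A : set T2, measurable A -> pushforward mu f A = nu A.

(* The gauge is a representative of its class in L^2, so symmetry is an almost
   everywhere statement. *)
Record gmSpace (R : realType) := GMSpace {
  gm_space :> ptopologicalType;
  gm_measure : probability (borel gm_space) R;
  gm_gauge : borel gm_space * borel gm_space -> R;
  gm_polish : polish R gm_space;
  gm_gauge_sym :
    {ae (gm_measure \x gm_measure)%E, forall z, gm_gauge z = gm_gauge (z.2, z.1)};
  gm_gauge_L2 : gm_gauge \in Lfun (gm_measure \x gm_measure)%E 2%:E
}.

Arguments gm_gauge {R} X z : rename.

Section gromov_wasserstein.
Context (R : realType).
Implicit Types X Y : gmSpace R.

Definition coupling X Y : set (probability (borel X * borel Y)%type R) :=
  [set pi | is_pushforward pi fst (gm_measure X) /\
            is_pushforward pi snd (gm_measure Y)].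

Arguments coupling : clear implicits.

Definition GWfun X Y (pi : probability (borel X * borel Y)%type R) : \bar R :=
  ((\int[pi]_z \int[pi]_z'
     (`|gm_gauge X (z.1, z'.1) - gm_gauge Y (z.2, z'.2)| ^+ 2)%:E) `^ 2^-1)%E.

Arguments GWfun : clear implicits.

Definition GW X Y : \bar R := ereal_inf [set GWfun X Y pi | pi in coupling X Y].

Definition opt_coupling X Y : set (probability (borel X * borel Y)%type R) :=
  [set pi | coupling X Y pi /\
            forall pi', coupling X Y pi' -> (GWfun X Y pi <= GWfun X Y pi')%E].

(* A [set] of gm-spaces would be a universe inconsistency, whence predicates. *)
Definition hom_class X : gmSpace R -> Prop := fun Y => GW X Y = 0%E.

Record GM := MkGM {
  gm_class :> gmSpace R -> Prop;
  gm_classP : exists X, gm_class = hom_class X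
}.

Definition toGM X : GM := MkGM (ex_intro _ X erefl).

Definition GMrepr (x : GM) : gmSpace R := projT1 (cid (gm_classP x)).

(* By the triangle inequality for [GW], the value does not depend on the chosen
   representatives. *)
Definition GWdist (x y : GM) : \bar R := GW (GMrepr x) (GMrepr y).

End gromov_wasserstein.

Arguments coupling {R} X Y.
Arguments GWfun {R} X Y pi.
Arguments opt_coupling {R} X Y.

Definition simplex (R : realType) (N : nat) : set ('I_N -> R) :=
  [set rho | (forall i, 0 <= rho i <= 1) /\ \sum_(i < N) rho i = 1].

Lemma dchoice (I : Type) (T : I -> Type) (P : forall i, T i -> Prop) :
  (forall i, exists x, P i x) -> exists f : forall i, T i, forall i, P i (f i).
Proof.
by move=> h; exists (fun i => projT1 (cid (h i))) => i; case: (cid (h i)).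
Qed.

Section polish_product.
Context (R : realType) (N : nat) (T : 'I_N -> ptopologicalType).

Lemma metric_ge0 (U : Type) (d : U -> U -> R) : is_metric d ->
  forall x y, 0 <= d x y.
Proof.
move=> [d0 ds dt] x y; have := dt x y x.
by rewrite (ds y x) (d0 x x).2// -mulr2n pmulrn_lge0.
Qed.

Lemma near_coordinates (f : prod_topology T) (P : forall i, set (T i)) :
  (forall i, nbhs (f i) (P i)) -> \forall g \near f, forall i, P i (g i).
Proof.
move=> fP; apply: (@filter_forall _ _ (fun i g => P i (g i)) (nbhs f)) => i.
exact: (@proj_continuous _ T i f _ (fP i)).
Qed.

Section with_metrics.
Variable d : forall i, T i -> T i -> R.
Arguments d : clear implicits.
Hypothesis md : forall i, is_metric (d i).
Hypothesis td : forall i, induces_topology (d i).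
Hypothesis cd : forall i, complete_metric (d i).

Let md0 i x y : d i x y = 0 <-> x = y. Proof. by case: (md i). Qed.

Definition sum_dist (f g : prod_topology T) : R := \sum_(i < N) d i (f i) (g i).

Lemma sum_dist_metric : is_metric sum_dist.
Proof.
split=> [f g|f g|f g h].
- split=> [/eqP|->]; last by apply: big1 => i _; exact: (md0 _ _).2.
  rewrite psumr_eq0 => [/allP fg0|i _]; last exact: metric_ge0.
  apply: functional_extensionality_dep => i.
  by apply: (md0 _ _).1; exact/eqP/fg0/mem_index_enum.
- by apply: eq_bigr => i _; case: (md i).
- by rewrite -big_split/=; apply: ler_sum => i _; case: (md i).
Qed.

Lemma le_sum_dist f g i : d i (f i) (g i) <= sum_dist f g.
Proof.
rewrite /sum_dist (bigD1 i)//= lerDl sumr_ge0// => j _; exact: metric_ge0.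
Qed.

Lemma sum_dist_ball f g e : 0 < e ->
  (forall i, d i (f i) (g i) < e / N.+1%:R) -> sum_dist f g < e.
Proof.
move=> e0 fg; rewrite (@le_lt_trans _ _ (\sum_(i < N) e / N.+1%:R))//.
  by apply: ler_sum => i _; exact: ltW.
rewrite sumr_const card_ord -mulrnAl ltr_pdivrMr ?ltr0n//.
by rewrite -mulr_natr ltr_pM2l// ltr_nat.
Qed.

Lemma sum_dist_topology : induces_topology sum_dist.
Proof.
move=> f A; split=> [|[e e0 eA]]; last first.
  apply: filterS eA _.
  apply: (@filterS _ _ _ [set g | forall i, d i (f i) (g i) < e / N.+1%:R]).
    by move=> g /= /sum_dist_ball; exact.
  apply: (@near_coordinates f (fun i => [set y | d i (f i) y < e / N.+1%:R])).
  by move=> i; apply/td; exists (e / N.+1%:R) => //; rewrite divr_gt0.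
pose F : set_system (prod_topology T) := [set B | exists2 e : R, 0 < e &
  [set y | sum_dist f y < e] `<=` B].
have FF : Filter F.
  split=> [|B C [e e0 eB] [e' e'0 eC]|B C BC [e e0 eB]].
  - by exists 1.
  - exists (Num.min e e'); first by rewrite lt_min e0.
    by move=> y /=; rewrite lt_min => /andP[/eB ? /eC].
  - by exists e => //; exact: subset_trans eB BC.
suff : F --> f by exact.
apply/cvg_sup => i B /= [_ [[C oC <-] Cf] CB].
have /td[e e0 eC] : nbhs (f i) C by exact: open_nbhs_nbhs.
exists e => // g /= fg; apply: CB; apply: eC => /=.
exact: le_lt_trans (le_sum_dist _ _ _) fg.
Qed.

Lemma sum_dist_complete : complete_metric sum_dist.
Proof.
move=> u ucauchy.
have /dchoice[l ul] : forall i, exists l : T i, (fun n => u n i) @ \oo --> l.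
  move=> i; apply: cd => e e0; have [n0 un0] := ucauchy _ e0.
  exists n0 => m n n0m n0n; apply: le_lt_trans (un0 _ _ n0m n0n).
  exact: le_sum_dist.
exists l => A /sum_dist_topology[e e0 eA].
suff : \forall n \near \oo, forall i, d i (l i) (u n i) < e / N.+1%:R.
  by apply: filterS => n /= /sum_dist_ball un; apply: eA; exact: un.
apply: (@filter_forall _ _ (fun i n => d i (l i) (u n i) < e / N.+1%:R)) => i.
apply: (ul i [set y | d i (l i) y < e / N.+1%:R]).
by apply/td; exists (e / N.+1%:R) => //; rewrite divr_gt0.
Qed.

Lemma separable_product : (forall i, separable (T i)) ->
  separable (prod_topology T).
Proof.
move=> sepT.
have /dchoice[s sP] : forall i, exists s : nat -> T i, dense (range s).
  move=> i; have [S cS dS] := sepT i.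
  have [x [_ Sx]] := dS _ (ex_intro _ point I) openT.
  have /pfcard_geP[S0|[s]] : (S #<= [set: nat])%card by exact: cS.
    by rewrite S0 in Sx.
  by exists s; rewrite image_eq.
pose F (n : {ffun 'I_N -> nat}) : prod_topology T := fun i => s i (n i).
exists (range F); first exact: (sub_countable (card_image_le _ _)).
move=> O [f Of] oO.
have /sum_dist_topology[e e0 eO] : nbhs f O by exact: open_nbhs_nbhs.
have /dchoice[n nP] : forall i : 'I_N, exists n : nat,
    d i (f i) (s i n) < e / N.+1%:R.
  move=> i.
  have : nbhs (f i) [set y | d i (f i) y < e / N.+1%:R].
    by apply/td; exists (e / N.+1%:R) => //; rewrite divr_gt0.
  rewrite nbhsE => -[B [oB Bf] Be].
  have [y [By [n _ ny]]] := sP i B (ex_intro _ _ Bf) oB.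
  by exists n; rewrite ny; exact: Be.
exists (F (finfun n)); split; last by exists (finfun n).
by apply: eO; apply: sum_dist_ball => // i; rewrite /F ffunE.
Qed.

End with_metrics.

Lemma polish_product : (forall i, polish R (T i)) -> polish R (prod_topology T).
Proof.
move=> pT.
have /dchoice[d dP] : forall i, exists d : T i -> T i -> R,
    [/\ is_metric d, induces_topology d & complete_metric d].
  by move=> i; case: (pT i).
have md i : is_metric (d i) by case: (dP i).
have td i : induces_topology (d i) by case: (dP i).
have cd i : complete_metric (d i) by case: (dP i).
split; first by apply: (separable_product md td) => i; case: (pT i).
exists (sum_dist d); split.
- exact: sum_dist_metric.
- exact: sum_dist_topology.
- exact: sum_dist_complete.
Qed.

End polish_product.

Section melting_space.
Context (R : realType) (N : nat) (X : 'I_N -> gmSpace R) (rho : 'I_N -> R).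

Definition prod_space : ptopologicalType := prod_topology (fun i => X i).

Definition prod_gauge (z : borel prod_space * borel prod_space) : R :=
  \sum_(i < N) rho i * gm_gauge (X i) (z.1 i, z.2 i).

Definition has_marginals (mu : probability (borel prod_space) R) : Prop :=
  forall i, is_pushforward mu (fun x : borel prod_space => x i : borel (X i))
              (gm_measure (X i)).

Lemma measurable_proj i : measurable_fun setT
  (fun x : borel prod_space => x i : borel (X i)).
Proof.
apply: (@measurability _ _ (borel prod_space) (borel (X i)) _ _ (@open (X i))) => [//|].
move=> _ [U oU <-].
apply: sub_sigma_algebra; rewrite setTI.
by move: U oU; apply/continuousP; exact: (@proj_continuous _ (fun i => X i) i).
Qed.

Let proj2 i (z : borel prod_space * borel prod_space) :
  borel (X i) * borel (X i) := (z.1 i, z.2 i).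

Let measurable_proj2 i : measurable_fun setT (@proj2 i).
Proof.
apply: measurable_fun_pair.
  exact: measurableT_comp (@measurable_proj i) measurable_fst.
exact: measurableT_comp (@measurable_proj i) measurable_snd.
Qed.

Section with_marginals.
Variables (mu : probability (borel prod_space) R) (muX : has_marginals mu).

Let proj2_product i : is_pushforward (mu \x mu)%E (@proj2 i)
  (gm_measure (X i) \x gm_measure (X i))%E.
Proof.
move=> A mA; apply/esym.
apply: (@product_measure_unique _ _ _ _ _ _ _
  (pushforward (mu \x mu)%E (@proj2 i))) => // B C mB mC.
rewrite /= /pushforward/=.
rewrite (_ : _ @^-1` _ = ((fun x : borel prod_space => x i) @^-1` B) `*`
   ((fun x : borel prod_space => x i) @^-1` C)); last by [].
rewrite product_measure1E//; last 2 first.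
- by rewrite -[X in measurable X]setTI; exact: measurable_proj.
- by rewrite -[X in measurable X]setTI; exact: measurable_proj.
by congr *%E; exact: muX.
Qed.

Lemma prod_gauge_sym :
  {ae (mu \x mu)%E, forall z, prod_gauge z = prod_gauge (z.2, z.1)}.
Proof.
have : {ae (mu \x mu)%E, forall z, forall i,
    gm_gauge (X i) (proj2 i z) = gm_gauge (X i) ((proj2 i z).2, (proj2 i z).1)}.
  apply: (@filter_forall _ _ (fun i z => gm_gauge (X i) (proj2 i z) =
    gm_gauge (X i) ((proj2 i z).2, (proj2 i z).1))) => i.
  have [B [mB B0 sB]] := gm_gauge_sym (X i).
  exists (@proj2 i @^-1` B); split.
  - by rewrite -[X in measurable X]setTI; exact: measurable_proj2.
  - by rewrite -B0; exact: proj2_product.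
  - by move=> z; exact: sB.
by apply: filterS => z zX; apply: eq_bigr => i _; rewrite (zX i).
Qed.

Lemma prod_gauge_L2 : prod_gauge \in Lfun (mu \x mu)%E 2%:E.
Proof.
have h12 : (1 <= 2%:E :> \bar R)%E by rewrite lee_fin ler1n.
rewrite (_ : prod_gauge = \sum_(i < N) rho i *: (gm_gauge (X i) \o @proj2 i)).
  have [L0 LD] := Lfun_submod_closed (mu \x mu)%E h12.
  elim/big_ind : _ => // [f g Lf Lg|i _].
    by rewrite -[f]scale1r; exact: LD.
  rewrite -[_ *: _]addr0; apply: LD => //.
  have /andP[/[!inE]/= mg] := gm_gauge_L2 (X i).
  rewrite /finite_norm unlock => g2.
  apply/andP; split; rewrite inE/=.
    exact: measurableT_comp mg (@measurable_proj2 i).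
  rewrite /finite_norm unlock.
  pose f y := (`|(gm_gauge (X i) y)%:E| `^ 2)%E.
  have mf : measurable_fun [set: (borel (X i) * borel (X i))%type] (f : _ -> \bar R).
    apply: (measurableT_comp (measurable_poweR 2)).
    by apply: measurableT_comp => //; exact/measurable_EFinP.
  have <- : (\int[(gm_measure (X i) \x gm_measure (X i))%E]_y f y =
      \int[(mu \x mu)%E]_x f (proj2 i x))%E.
    rewrite -[RHS](ge0_integral_pushforward (@measurable_proj2 i)
      (mu \x mu)%E measurableT mf).
      apply: eq_measure_integral => A mA _; exact/esym/proj2_product.
    by move=> y _; exact: poweR_ge0.
  exact: g2.
apply/funext => z; rewrite /prod_gauge.
by rewrite -[RHS]/((fun f => f z) _) fct_sumE.
Qed.

(* The gm-space (X_1 * ... * X_N, m_rho, mu) with m_rho = [prod_gauge]; the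
   marginals of [mu] are what makes m_rho square integrable. *)
Definition melting_space : gmSpace R :=
  @GMSpace R prod_space mu prod_gauge
    (polish_product (fun i => gm_polish (X i))) prod_gauge_sym prod_gauge_L2.

End with_marginals.
End melting_space.

Arguments has_marginals {R N} X mu.
Arguments melting_space {R N X} rho {mu} muX.

Section tangential_barycenter.
Context (R : realType) (N : nat).
Implicit Types (X : 'I_N -> gmSpace R) (Y : gmSpace R).

Definition gluing Y X (pi : forall i, probability (borel Y * borel (X i))%type R) :
    set (probability (borel Y * borel (prod_space X))%type R) :=
  [set gamma | forall i, is_pushforward gamma
     (fun z : borel Y * borel (prod_space X) => (z.1, z.2 i) : borel Y * borel (X i))
     (pi i)].

Definition melting Y X (pi : forall i, probability (borel Y * borel (X i))%type R) :
    set (probability (borel (prod_space X)) R) :=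
  [set mu | exists2 gamma, gluing pi gamma & is_pushforward gamma snd mu].

Definition opt_melting Y X : set (probability (borel (prod_space X)) R) :=
  [set mu | exists2 pi : forall i, probability (borel Y * borel (X i))%type R,
     forall i, opt_coupling Y (X i) (pi i) & melting pi mu].

Arguments opt_melting : clear implicits.

Lemma opt_melting_marginals Y X mu : opt_melting Y X mu -> has_marginals X mu.
Proof.
move=> [pi piO [gamma gpi gmu]] i A mA.
have [[_ piX] _] := piO i.
rewrite -piX// /pushforward -gpi; last first.
  by rewrite -[A in measurable A]setTI; exact: measurable_snd.
rewrite -[LHS]gmu//.
by rewrite -[X in measurable X]setTI; exact: measurable_proj.
Qed.

Definition TB_at (rho : 'I_N -> R) X Y : GM R -> Prop := fun z =>
  exists (mu : probability (borel (prod_space X)) R) (muO : opt_melting Y X mu),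
    z = toGM (melting_space rho (opt_melting_marginals muO)).

(* [TB_at rho X Y] only depends on the class of [Y]: the union over all
   representatives is its common value. *)
Definition TB (rho : 'I_N -> R) X (y : GM R) : GM R -> Prop := fun z =>
  exists2 Y, y Y & TB_at rho X Y z.

End tangential_barycenter.

Arguments gluing {R N} Y X pi.
Arguments melting {R N} Y X pi.
Arguments opt_melting {R N} Y X.

(* Main.v *)
Require Import Defs.
From HB Require Import structures.
From mathcomp Require Import all_boot all_order all_algebra.
From mathcomp Require Import all_classical all_reals all_analysis measurable_realfun ring lra.

(* For gamma a gluing of optimal couplings of Y with the X_i and Z the
   corresponding melting, expanding squares gives
     sum_i rho_i GW(Y, X_i)^2
       = ||h - m_rho||^2 + sum_i rho_i ||m_rho - g_i||^2
       >= ||h - m_rho||^2 + sum_i rho_i GW(Z, X_i)^2,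
   norms being taken in L^2(gamma x gamma). Along the iteration the gaps
   ||h_n - m_rho|| >= GW(Y_n, Y_(n+1)) thus tend to 0.

   All Y_(n+1) live on the same product of Polish spaces, with measures mu_n of
   fixed marginals. Along a nonprincipal ultrafilter these measures converge, on
   all measurable boxes, to a probability nu: the limit is an additive function
   on an algebra of sets that is inner regular for compact sets uniformly in n,
   hence it is countably additive there. As every square integrable gauge is
   nearly constant on the cells of a finite partition, mu_n and nu can be coupled
   cell by cell so that all the g_i hardly change, whence GW-convergence.

   Each projection X_1 x ... x X_N -> X_i costs ||m_rho - g_i|| in L^2(nu x nu).
   It is optimal since ||m_rho - g_i|| <= ||m_rho - h_n|| + GW(Y_n, X_i) before
   the limit, even if rho_i = 0. Gluing these projections gives nu back, so that
   the limit is one of its own tangential barycenters. *)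

Set Implicit Arguments.
Unset Strict Implicit.
Unset Printing Implicit Defensive.

Import Order.TTheory GRing.Theory Num.Theory.
Import numFieldNormedType.Exports.
Local Open Scope classical_set_scope.
Local Open Scope ring_scope.

(** * The L^2 norm of kernels and the Gromov-Wasserstein cost *)

(** Gauges are merely square integrable, so weak convergence of the mu_n does not directly control
    the costs. Convergence of the masses of measurable boxes is what step approximations of the
    gauges can use, and it is available because the marginals are fixed: shrinking the sides of a
    box to compact sets loses a mass that is bounded by the marginals alone. An ultrafilter gives
    limits on all the uncountably many boxes at once; a genuine subsequence is extracted only at the
    end, from the estimates along the ultrafilter.

    Disintegration is avoided throughout. Measures are coupled by coupling the masses of finitely
    many cells and using multiples of the product measure inside the cells. Such a coupling matches
    points only up to their cells, and the error is paid in the L^2 norm of the gauges. Costs are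
    compared on a common probability space, to which all gauges are pulled back. *)

Definition lift_kernel (E X S : Type) (u : E -> X) (f : X * X -> S) (z : E * E) : S :=
  f (u z.1, u z.2).

Definition knorm (R : realType) (d : measure_display) (E : measurableType d)
    (P : probability E R) (f : E * E -> R) : \bar R :=
  ('N[(P \x P)%E]_2%:E [EFin \o f])%E.

Section kernel_norm.
Context (R : realType).

Lemma measurable_pair_map (d d' : measure_display) (E : measurableType d)
    (X : measurableType d') (u : E -> X) : measurable_fun setT u ->
  measurable_fun setT (fun z : E * E => (u z.1, u z.2)).
Proof.
move=> mu; by apply: measurable_fun_pair; apply: measurableT_comp.
Qed.

Lemma measurable_lift_kernel (d d' : measure_display) (E : measurableType d)
    (X : measurableType d') (u : E -> X) (f : X * X -> R) :
  measurable_fun setT u -> measurable_fun setT f ->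
  measurable_fun setT (lift_kernel u f).
Proof. by move=> mu mf; apply: measurableT_comp mf (measurable_pair_map mu). Qed.

Lemma is_pushforward_product (d d' : measure_display) (E : measurableType d)
    (X : measurableType d') (P : probability E R) (Q : probability X R) (u : E -> X) :
  measurable_fun setT u -> is_pushforward P u Q ->
  is_pushforward (P \x P)%E (fun z : E * E => (u z.1, u z.2)) (Q \x Q)%E.
Proof.
move=> mu PQ A mA; apply/esym.
have mu2 := measurable_pair_map mu.
apply: (@product_measure_unique _ _ _ _ _ Q Q
  (pushforward (P \x P)%E (fun z : E * E => (u z.1, u z.2)))) => // B C mB mC.
rewrite /= /pushforward/=.
rewrite (_ : _ @^-1` _ = (u @^-1` B) `*` (u @^-1` C)); last by [].
rewrite product_measure1E//; last 2 first.
- by rewrite -[X in measurable X]setTI; exact: mu.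
- by rewrite -[X in measurable X]setTI; exact: mu.
by congr *%E; exact: PQ.
Qed.

Lemma ge0_integral_is_pushforward (d d' : measure_display) (E : measurableType d)
    (X : measurableType d') (P : {measure set E -> \bar R})
    (Q : {measure set X -> \bar R}) (u : E -> X) (f : X -> \bar R) :
  measurable_fun setT u -> is_pushforward P u Q ->
  measurable_fun setT f -> (forall x, 0 <= f x)%E ->
  (\int[Q]_x f x = \int[P]_x f (u x))%E.
Proof.
move=> mu PQ mf f0.
rewrite -[RHS](ge0_integral_pushforward mu P measurableT mf); last by move=> y _.
by apply: eq_measure_integral => A mA _; exact/esym/PQ.
Qed.

Lemma poweR_sqr (x : \bar R) : (0 <= x -> x `^ 2 = x ^+ 2)%E.
Proof.
case: x => [x| |//]; last by rewrite poweRyr.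
by rewrite lee_fin => x0; rewrite poweR_EFin powR_mulrn// EFin_expe.
Qed.

Context (d : measure_display) (E : measurableType d) (P : probability E R).
Implicit Types f g : E * E -> R.

Lemma knorm_ge0 f : (0 <= knorm P f)%E.
Proof. exact: Lnorm_ge0. Qed.

Lemma knormE f : knorm P f =
  ((\int[(P \x P)%E]_z (f z ^+ 2)%:E) `^ 2^-1)%E.
Proof.
rewrite /knorm unlock; congr poweR; apply: eq_integral => z _.
by rewrite /= powR_mulrn// real_normK// num_real.
Qed.

Lemma knorm_sqr f : (knorm P f ^+ 2 = \int[(P \x P)%E]_z (f z ^+ 2)%:E)%E.
Proof.
rewrite -poweR_sqr ?knorm_ge0// knormE -poweRrM mulVf// poweRe1//.
by apply: integral_ge0 => z _; rewrite lee_fin sqr_ge0.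
Qed.

Lemma knorm_le f (e : R) : 0 <= e ->
  (\int[(P \x P)%E]_z (f z ^+ 2)%:E <= (e ^+ 2)%:E -> knorm P f <= e%:E)%E.
Proof.
move=> e0 h; rewrite knormE.
apply: (@le_trans _ _ ((e ^+ 2)%:E `^ 2^-1)%E).
  apply: gt0_ler_poweR => //.
  - rewrite in_itv/= leey andbT.
    by apply: integral_ge0 => z _; rewrite lee_fin sqr_ge0.
  - by rewrite in_itv/= leey andbT lee_fin sqr_ge0.
rewrite poweR_EFin lee_fin -powR_mulrn// -powRrM mulfV// powRr1//.
Qed.

Lemma knormD f g : measurable_fun setT f -> measurable_fun setT g ->
  (knorm P (f \+ g)%R <= knorm P f + knorm P g)%E.
Proof. by move=> mf mg; apply: minkowski_EFin => //; rewrite ler1n. Qed.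

Lemma knormN f : knorm P (\- f)%R = knorm P f.
Proof. by rewrite !knormE; under eq_integral do rewrite /= sqrrN. Qed.

Lemma knormBC f g : knorm P (f \- g)%R = knorm P (g \- f)%R.
Proof. by rewrite -knormN; congr knorm; apply/funext => z/=; rewrite opprB. Qed.

Lemma knormB f g : measurable_fun setT f -> measurable_fun setT g ->
  (knorm P (f \- g)%R <= knorm P f + knorm P g)%E.
Proof.
move=> mf mg; rewrite -(knormN g); apply: knormD => //.
exact: measurableT_comp.
Qed.

Lemma knorm_triangle f g h :
  measurable_fun setT f -> measurable_fun setT g -> measurable_fun setT h ->
  (knorm P (f \- h)%R <= knorm P (f \- g)%R + knorm P (g \- h)%R)%E.
Proof.
move=> mf mg mh; rewrite (_ : f \- h = (f \- g) \+ (g \- h)).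
  by apply: knormD; exact: measurable_funB.
by apply/funext => z/=; ring.
Qed.

Lemma le_knorm f g : measurable_fun setT f -> measurable_fun setT g ->
  (forall z, `|f z| <= `|g z|) -> (knorm P f <= knorm P g)%E.
Proof.
move=> mf mg fg; rewrite !knormE; apply: gt0_ler_poweR => //.
- rewrite in_itv/= leey andbT.
  by apply: integral_ge0 => z _; rewrite lee_fin sqr_ge0.
- rewrite in_itv/= leey andbT.
  by apply: integral_ge0 => z _; rewrite lee_fin sqr_ge0.
apply: ge0_le_integral => //.
- by move=> z _; rewrite lee_fin sqr_ge0.
- by apply/measurable_EFinP; exact: measurable_funX.
- by apply/measurable_EFinP; exact: measurable_funX.
move=> z _; rewrite lee_fin -(real_normK (num_real (f z))) -(real_normK (num_real (g z))).
by rewrite lerXn2r// nnegrE.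
Qed.

Lemma knorm_cst (c : R) : knorm P (cst c) = `|c|%:E.
Proof.
rewrite knormE (@integral_cst _ _ _ (P \x P)%E _ measurableT (c ^+ 2)%:E).
rewrite [X in (_ * X)%E](_ : _ = 1%E); last exact: probability_setT.
rewrite mule1 poweR_EFin.
by rewrite -real_normK ?num_real// -powR_mulrn// -powRrM mulfV// powRr1//.
Qed.

Lemma knormZ (c : R) f : measurable_fun setT f ->
  knorm P (fun z => c * f z) = (`|c|%:E * knorm P f)%E.
Proof.
move=> mf; rewrite !knormE.
under eq_integral do rewrite exprMn EFinM.
rewrite ge0_integralZl//.
- rewrite poweRM// ?lee_fin ?sqr_ge0//.
    rewrite poweR_EFin -real_normK ?num_real// -powR_mulrn// -powRrM mulfV// powRr1//.
  by apply: integral_ge0 => z _; rewrite lee_fin sqr_ge0.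
- by apply/measurable_EFinP; exact: measurable_funX.
- by move=> z _; rewrite lee_fin sqr_ge0.
- by rewrite lee_fin sqr_ge0.
Qed.

End kernel_norm.

(** Change of variables: an L^2 estimate may be carried out on any probability space that maps onto
    the one where it is wanted. *)
Lemma knorm_lift (R : realType) (d d' : measure_display) (E : measurableType d)
    (X : measurableType d') (P : probability E R) (Q : probability X R) (u : E -> X) (f : X * X -> R) :
  measurable_fun setT u -> is_pushforward P u Q -> measurable_fun setT f ->
  knorm P (lift_kernel u f) = knorm Q f.
Proof.
move=> mu PQ mf; rewrite !knormE; congr (_ `^ _)%E; apply/esym.
apply: (@ge0_integral_is_pushforward _ _ _ _ _ _ _
  (fun z : E * E => (u z.1, u z.2)) (fun z => (f z ^+ 2)%:E)).
- exact: measurable_pair_map.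
- exact: is_pushforward_product.
- by apply/measurable_EFinP; exact: measurable_funX.
- by move=> x; rewrite lee_fin sqr_ge0.
Qed.

Lemma is_pushforward_comp (R : realType) (d1 d2 d3 : measure_display)
    (T1 : measurableType d1) (T2 : measurableType d2) (T3 : measurableType d3)
    (P : set T1 -> \bar R) (u : T1 -> T2) (Q : set T2 -> \bar R) (v : T2 -> T3)
    (S : set T3 -> \bar R) : measurable_fun setT v ->
  is_pushforward P u Q -> is_pushforward Q v S <-> is_pushforward P (v \o u) S.
Proof.
move=> mv PQ.
have mvA A : measurable A -> measurable (v @^-1` A).
  by move=> mA; rewrite -[X in measurable X]setTI; exact: mv.
by split=> h A mA; rewrite -(h A mA); [exact/PQ/mvA|exact/esym/PQ/mvA].
Qed.

Lemma ex_pushforward (R : realType) (d d' : measure_display) (E : measurableType d)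
    (X : measurableType d') (P : probability E R) (u : E -> X) :
  measurable_fun setT u -> exists Q : probability X R, is_pushforward P u Q.
Proof.
move=> mu; pose U : {mfun E >-> X} := HB.pack u (isMeasurableFun.Build _ _ _ _ u mu).
by exists (distribution P U).
Qed.

Lemma product_measure_fst (R : realType) (d d' : measure_display)
    (E : measurableType d) (F : measurableType d') (P : probability E R)
    (Q : probability F R) : is_pushforward (P \x Q)%E fst P.
Proof.
move=> A mA; rewrite /pushforward (_ : _ @^-1` _ = A `*` setT).
  rewrite product_measure1E// [X in (_ * X)%E](_ : _ = 1%E) ?mule1//.
  exact: probability_setT.
by apply/seteqP; split=> [z|z []].
Qed.

Lemma product_measure_snd (R : realType) (d d' : measure_display)
    (E : measurableType d) (F : measurableType d') (P : probability E R)
    (Q : probability F R) : is_pushforward (P \x Q)%E snd Q.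
Proof.
move=> A mA; rewrite /pushforward (_ : _ @^-1` _ = setT `*` A).
  rewrite product_measure1E// [X in (X * _)%E](_ : _ = 1%E) ?mul1e//.
  exact: probability_setT.
by apply/seteqP; split=> [z|z []].
Qed.

Section gromov_wasserstein_distance.
Context (R : realType).
Implicit Types X Y Z : gmSpace R.

Lemma measurable_gauge X : measurable_fun setT (@gm_gauge R X).
Proof. by have /andP[/[!inE]] := gm_gauge_L2 X. Qed.
Hint Resolve measurable_gauge : core.

Lemma knorm_gauge_lty X : (knorm (gm_measure X) (@gm_gauge R X) < +oo)%E.
Proof. by have /andP[_ /[!inE]] := gm_gauge_L2 X. Qed.

Lemma GWfunE X Y (pi : probability (borel X * borel Y)%type R) :
  GWfun X Y pi =
  knorm pi (lift_kernel fst (@gm_gauge R X) \- lift_kernel snd (@gm_gauge R Y))%R.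
Proof.
have mf : measurable_fun setT
    (lift_kernel fst (@gm_gauge R X) \- lift_kernel snd (@gm_gauge R Y) :
      (borel X * borel Y) * (borel X * borel Y) -> R).
  by apply: measurable_funB; exact: measurable_lift_kernel.
rewrite knormE fubini_tonelli1; last 2 first.
- by apply/measurable_EFinP; exact: measurable_funX.
- by move=> z; rewrite lee_fin sqr_ge0.
apply: (congr1 (fun x => x `^ 2^-1)%E).
apply: eq_integral => z _; apply: eq_integral => z' _.
by rewrite real_normK// num_real.
Qed.

Section parametrized_coupling.
Variables (X Y : gmSpace R) (d : measure_display) (E : measurableType d).
Variables (P : probability E R) (u : E -> borel X) (v : E -> borel Y).
Hypotheses (mu : measurable_fun setT u) (mv : measurable_fun setT v).
Hypothesis Pu : is_pushforward P u (gm_measure X).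
Hypothesis Pv : is_pushforward P v (gm_measure Y).

Let muv : measurable_fun setT (fun e => (u e, v e)).
Proof. exact: measurable_fun_pair. Qed.

Lemma coupling_pushforward (pi : probability (borel X * borel Y)%type R) :
  is_pushforward P (fun e => (u e, v e)) pi -> coupling X Y pi.
Proof.
move=> Ppi; split.
- by apply/(is_pushforward_comp _ _ Ppi).
- by apply/(is_pushforward_comp _ _ Ppi).
Qed.

Lemma GWfun_pushforward (pi : probability (borel X * borel Y)%type R) :
  is_pushforward P (fun e => (u e, v e)) pi ->
  GWfun X Y pi = knorm P
    (lift_kernel u (@gm_gauge R X) \- lift_kernel v (@gm_gauge R Y))%R.
Proof.
move=> Ppi; rewrite GWfunE -(knorm_lift muv Ppi)//.
by apply: measurable_funB; exact: measurable_lift_kernel.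
Qed.

(** Two maps with the right laws on a common probability space induce a coupling whose cost is this
    norm. Upper bounds on [GW] thus never require writing down a measure on [X * Y]. *)
Lemma GW_le : (GW X Y <= knorm P
  (lift_kernel u (@gm_gauge R X) \- lift_kernel v (@gm_gauge R Y))%R)%E.
Proof.
have [pi Ppi] := ex_pushforward P muv.
rewrite -(GWfun_pushforward Ppi); apply: ereal_inf_lbound.
by exists pi => //; exact: coupling_pushforward.
Qed.

Lemma knorm_coupling_le :
  (knorm P (lift_kernel u (@gm_gauge R X) \- lift_kernel v (@gm_gauge R Y))%R <=
   knorm (gm_measure X) (@gm_gauge R X) + knorm (gm_measure Y) (@gm_gauge R Y))%E.
Proof.
rewrite -(knorm_lift mu Pu)// -(knorm_lift mv Pv)//.
by apply: knormB; exact: measurable_lift_kernel.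
Qed.

End parametrized_coupling.

Lemma GW_ge0 X Y : (0 <= GW X Y)%E.
Proof. by apply: le_ereal_inf_tmp => _ [pi _ <-]; rewrite GWfunE knorm_ge0. Qed.

Lemma GW_fin_num X Y : GW X Y \is a fin_num.
Proof.
rewrite ge0_fin_numE ?GW_ge0//.
pose P : probability (borel X * borel Y)%type R := (gm_measure X \x gm_measure Y)%E.
have P1 := product_measure_fst (gm_measure X) (gm_measure Y).
have P2 := product_measure_snd (gm_measure X) (gm_measure Y).
apply: (le_lt_trans (GW_le measurable_fst measurable_snd P1 P2)).
apply: (le_lt_trans (knorm_coupling_le measurable_fst measurable_snd P1 P2)).
by rewrite lte_add_pinfty// knorm_gauge_lty.
Qed.

(** A coupling of [Y] and [X] is itself a common probability space for [X] and [Y], with [snd] and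
    [fst] as the two maps. *)
Lemma GW_sym_le X Y : (GW X Y <= GW Y X)%E.
Proof.
apply: le_ereal_inf_tmp => _ [pi [p1 p2] <-].
rewrite GWfunE knormBC; exact: GW_le.
Qed.

Lemma GW_sym X Y : GW X Y = GW Y X.
Proof. by apply/eqP; rewrite eq_le !GW_sym_le. Qed.

Lemma GW_xx X : GW X X = 0%E.
Proof.
apply/eqP; rewrite eq_le GW_ge0 andbT.
have mid : measurable_fun setT (@id (borel X)) by exact: measurable_id.
have pid : is_pushforward (gm_measure X) (@id (borel X)) (gm_measure X) by [].
apply: (le_trans (GW_le mid mid pid pid)).
rewrite (_ : (_ \- _)%R = cst 0) ?knorm_cst ?normr0//.
by apply/funext => z /=; rewrite subrr.
Qed.

Lemma GW_adherent X Y (e : R) : 0 < e ->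
  exists2 pi, coupling X Y pi & (GWfun X Y pi < GW X Y + e%:E)%E.
Proof.
move=> e0; have := lb_ereal_inf_adherent e0 (GW_fin_num X Y).
by move=> [_ [pi cpi <-]] h; exists pi.
Qed.

End gromov_wasserstein_distance.

Arguments measurable_gauge {R} X.
Arguments knorm_gauge_lty {R} X.

(** * Couplings with prescribed cell masses *)

Section unit_mass.
Context (R : realType) (d : measure_display) (E : measurableType d)
  (mu : {measure set E -> \bar R}).

(** The proof of unit mass is an argument of this alias so that a probability structure can be
    declared on it. *)
Definition unit_mass_probability of mu setT = 1%E := (mu : set E -> \bar R).

Hypothesis mu1 : mu setT = 1%E.
HB.instance Definition _ := Measure.on (unit_mass_probability mu1).
HB.instance Definition _ :=
  Measure_isProbability.Build _ _ _ (unit_mass_probability mu1) mu1.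

Lemma ex_probability : exists P : probability E R, forall A, P A = mu A.
Proof. by exists (unit_mass_probability mu1). Qed.

End unit_mass.

Section finite_labels.
Context (R : realType) (d : measure_display) (E : measurableType d) (K : finType).

Definition label_measurable (a : E -> K) :=
  forall k, measurable (a @^-1` [set k]).

Lemma finite_sum_measure (I : finType) (m : I -> {measure set E -> \bar R}) :
  exists M : {measure set E -> \bar R}, forall A, (M A = \sum_i m i A)%E.
Proof.
(* [msum] runs over naturals: [n] stands for the element of [I] of rank [n], and the default [mzero]
   is never reached below [#|I|]. *)
pose m' n : {measure set E -> \bar R} :=
  if (insub n : option 'I_#|I|) is Some o then m (enum_val o) else mzero.
exists (msum m' #|I|) => A.
rewrite [RHS](reindex (@enum_val I I)) /=; last exact/onW_bij/enum_val_bij.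
by apply: eq_bigr => i _; rewrite /m' valK.
Qed.

Lemma measure_label_sum (mu : {measure set E -> \bar R}) (a : E -> K) A :
  label_measurable a -> measurable A ->
  (mu A = \sum_k mu (A `&` a @^-1` [set k]))%E.
Proof.
move=> ma mA.
have AE : A = \bigcup_(k in [set` index_enum K]) (A `&` a @^-1` [set k]).
  apply/seteqP; split=> [x Ax|x [k _ []]//].
  by exists (a x) => //=; exact: mem_index_enum.
rewrite {1}AE measure_fin_bigcup//.
- by rewrite -fsbig_seq// index_enum_uniq.
- by apply/trivIsetP => j k _ _ /eqP jk; rewrite setIACA setIid -subset0 => x [_ []] /= -> /jk.
by move=> k _; exact: measurableI.
Qed.

End finite_labels.

Section label_coupling.
Context (R : realType) (d d' : measure_display) (E : measurableType d)
  (F : measurableType d') (K : finType) (P : probability E R) (Q : probability F R).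
Variables (a : E -> K) (b : F -> K) (w : K -> K -> R).
Hypotheses (ma : label_measurable a) (mb : label_measurable b).
Hypothesis w0 : forall j k, 0 <= w j k.
Hypothesis Pw : forall j, P (a @^-1` [set j]) = (\sum_k w j k)%:E.
Hypothesis Qw : forall k, Q (b @^-1` [set k]) = (\sum_j w j k)%:E.

Let p j : R := \sum_k w j k.
Let q k : R := \sum_j w j k.
(* On the cell (j, k) the coupling is proportional to the product measure;
   [x / 0 = 0] takes care of null cells. *)
Let c j k := w j k / (p j * q k).

Let p0 j : 0 <= p j. Proof. exact: sumr_ge0. Qed.
Let q0 k : 0 <= q k. Proof. exact: sumr_ge0. Qed.
Let c0 j k : 0 <= c j k. Proof. by rewrite divr_ge0 ?mulr_ge0. Qed.

Let pw j k : p j = 0 -> w j k = 0.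
Proof. by move=> /eqP; rewrite psumr_eq0// => /allP/(_ k (mem_index_enum _))/eqP. Qed.

Let qw j k : q k = 0 -> w j k = 0.
Proof.
by move=> /eqP; rewrite psumr_eq0// => /allP/(_ j (mem_index_enum _))/eqP.
Qed.

Let cpq j k : c j k * (p j * q k) = w j k.
Proof.
rewrite /c; have [/pw->|pn0] := eqVneq (p j) 0; first by rewrite !mul0r.
have [/qw->|qn0] := eqVneq (q k) 0; first by rewrite !mul0r.
by rewrite divfK// mulf_neq0.
Qed.

Let cq j : p j != 0 -> \sum_k c j k * q k = 1.
Proof.
move=> pj; apply: (mulfI pj); rewrite mulr1 mulr_sumr /p.
by apply: eq_bigr => k _; rewrite mulrCA cpq.
Qed.

Let cp k : q k != 0 -> \sum_j c j k * p j = 1.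
Proof.
move=> qk; apply: (mulIf qk); rewrite mul1r mulr_suml /q.
by apply: eq_bigr => j _; rewrite -mulrA cpq.
Qed.

Let cell (jk : K * K) := (a @^-1` [set jk.1]) `*` (b @^-1` [set jk.2]).

Let mcell jk : measurable (cell jk).
Proof. exact: measurableX. Qed.

(** A coupling [w] of the laws of the labels lifts to the measures: given its two labels, the pair
    of points is drawn independently from the two cells. *)
Lemma label_coupling : exists G : probability (E * F)%type R,
  [/\ is_pushforward G fst P, is_pushforward G snd Q &
      forall j k, G ((a @^-1` [set j]) `*` (b @^-1` [set k])) = (w j k)%:E].
Proof.
have [G GE] := finite_sum_measure (fun jk : K * K =>
  mscale (NngNum (c0 jk.1 jk.2)) (mrestr (P \x Q)%E (mcell jk))).
have GX A B : measurable A -> measurable B -> (G (A `*` B) =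
    \sum_j \sum_k (c j k)%:E * (P (A `&` a @^-1` [set j]) * Q (B `&` b @^-1` [set k])))%E.
  move=> mA mB; rewrite GE pair_big/=; apply: eq_bigr => -[j k] _ /=.
  rewrite /mscale/= /mrestr/=; congr (_ * _)%E.
  by rewrite /cell/= -setXI product_measure1E//; exact: measurableI.
have G1 : is_pushforward G fst P.
  move=> A mA; rewrite /pushforward (_ : _ @^-1` _ = A `*` setT); last first.
    by apply/seteqP; split=> [z|z []].
  rewrite GX// (measure_label_sum P ma mA); apply: eq_bigr => j _.
  (* On a null cell both sides vanish; elsewhere the marginal is right because the weights
     [c j k * q k] sum to 1 over [k]. *)
  have [pj|pj] := eqVneq (p j) 0.
    have PA0 : (P (A `&` a @^-1` [set j]) = 0)%E.
      apply: (@subset_measure0 _ _ _ _ _ (a @^-1` [set j])) => //.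
      - exact: measurableI.
      - exact: (etrans (Pw j) (congr1 EFin pj)).
    by rewrite PA0 big1// => k _; rewrite mul0e mule0.
  under eq_bigr do rewrite setTI Qw -/(q _) [in X in (_ * X)%E]muleC muleA -EFinM.
  rewrite -ge0_sume_distrl; last by move=> k _; rewrite lee_fin mulr_ge0.
  by rewrite sumEFin cq// mul1e.
have G2 : is_pushforward G snd Q.
  move=> A mA; rewrite /pushforward (_ : _ @^-1` _ = setT `*` A); last first.
    by apply/seteqP; split=> [z|z []].
  rewrite GX// exchange_big/= (measure_label_sum Q mb mA); apply: eq_bigr => k _.
  have [qk|qk] := eqVneq (q k) 0.
    have QA0 : (Q (A `&` b @^-1` [set k]) = 0)%E.
      apply: (@subset_measure0 _ _ _ _ _ (b @^-1` [set k])) => //.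
      - exact: measurableI.
      - exact: (etrans (Qw k) (congr1 EFin qk)).
    by rewrite QA0 big1// => j _; rewrite mule0 mule0.
  under eq_bigr do rewrite setTI Pw -/(p _) muleA -EFinM.
  rewrite -ge0_sume_distrl; last by move=> j _; rewrite lee_fin mulr_ge0.
  by rewrite sumEFin cp// mul1e.
have GT : G setT = 1%E.
  rewrite -[setT](@preimage_setT _ _ fst) -[LHS]/(pushforward G fst setT) G1//.
  exact: probability_setT.
have [G' G'E] := ex_probability GT.
exists G'; split=> [A mA|A mA|j k].
- by rewrite -G1// /pushforward G'E.
- by rewrite -G2// /pushforward G'E.
rewrite G'E GE (bigD1 (j, k))//= big1 ?adde0; last first.
  move=> [j' k'] jk; rewrite /mscale/= /mrestr/= /cell/= -setXI.
  rewrite (_ : _ `*` _ = set0) ?measure0 ?mule0//.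
  rewrite -subset0 => -[x y] /= [[ax ax'] [bx bx']].
  by move: jk; rewrite -ax' -bx' ax bx eqxx.
rewrite /mscale/= /mrestr/= /cell/= setIid product_measure1E//.
by rewrite [X in (_ * (X * _))%E]Pw [X in (_ * (_ * X))%E]Qw -!EFinM cpq.
Qed.

End label_coupling.

Lemma measurable_label (d : measure_display) (E : measurableType d) (K : finType) (a : E -> K) (B : set K) :
  label_measurable a -> measurable (a @^-1` B).
Proof.
move=> ma; rewrite (_ : _ @^-1` _ = \bigcup_(k in B) a @^-1` [set k]).
  apply: fin_bigcup_measurable => [|k _]; last exact: ma.
  exact: (@sub_finite_set _ _ [set: K]).
apply/seteqP; split=> [x Bx|x [k Bk axk]]; first by exists (a x).
by rewrite /preimage/= axk.
Qed.

Section label_measurability.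
Context (R : realType) (d : measure_display) (E : measurableType d).

Lemma label_measurable_pair (d' : measure_display) (F : measurableType d')
    (K L : finType) (a : E -> K) (b : F -> L) :
  label_measurable a -> label_measurable b ->
  label_measurable (fun z : E * F => (a z.1, b z.2)).
Proof.
move=> ma mb [j k]; rewrite (_ : _ @^-1` _ = (a @^-1` [set j]) `*` (b @^-1` [set k])).
  exact: measurableX.
by apply/seteqP; split=> [z [<- <-]//|[x y] [/= <- <-]].
Qed.

Lemma measurable_lift_label (K : finType) (a : E -> K) (s : K * K -> R) :
  label_measurable a -> measurable_fun setT (lift_kernel a s).
Proof.
move=> ma _ B mB; rewrite setTI /lift_kernel.
rewrite -[X in measurable X]/((fun z : E * E => (a z.1, a z.2)) @^-1` (s @^-1` B)).
apply: measurable_label; exact: label_measurable_pair.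
Qed.

Lemma label_measurable_comp (d' : measure_display) (F : measurableType d')
    (K : finType) (a : E -> K) (u : F -> E) :
  measurable_fun setT u -> label_measurable a -> label_measurable (a \o u).
Proof.
by move=> mu ma k; rewrite comp_preimage -[X in measurable X]setTI; exact: mu.
Qed.

End label_measurability.

Section label_closeness.
Context (R : realType) (d d' : measure_display) (E : measurableType d)
  (F : measurableType d') (K : finType) (P : probability E R) (Q : probability F R).
Variables (a : E -> K) (b : F -> K) (G : probability (E * F)%type R).
Hypotheses (ma : label_measurable a) (mb : label_measurable b).
Hypotheses (GP : is_pushforward G fst P) (GQ : is_pushforward G snd Q).

Let D := [set z : E * F | a z.1 != b z.2].

Let mab : label_measurable (fun z : E * F => (a z.1, b z.2)).
Proof. exact: label_measurable_pair. Qed.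

Let mD : measurable D.
Proof.
rewrite -[D]/((fun z : E * F => (a z.1, b z.2)) @^-1` [set jk : K * K | jk.1 != jk.2]).
exact: measurable_label.
Qed.

Lemma label_mismatch (w : K -> K -> R) :
  (forall j k, G ((a @^-1` [set j]) `*` (b @^-1` [set k])) = (w j k)%:E) ->
  G D = (\sum_(jk | jk.1 != jk.2) w jk.1 jk.2)%:E.
Proof.
move=> Gw; rewrite (measure_label_sum G mab mD) -sumEFin [RHS]big_mkcond/=.
apply: eq_bigr => -[j k] _ /=; case: ifPn => [jk|/negPn/eqP <-].
  rewrite -Gw; congr (G _); apply/seteqP; split=> [z [_ [<- <-]]//|z [/= zj zk]].
  by rewrite /D/= zj zk.
rewrite (_ : _ `&` _ = set0) ?measure0//; rewrite -subset0 => z [].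
by rewrite /D/= => /[swap] -[-> ->]; rewrite eqxx.
Qed.

(** The pulled back step kernels can differ at (z, z') only if z or z' lies in [D], an event of mass
    at most twice that of [D]; there the squared difference is at most [C]. *)
Lemma knorm_label_mismatch (s : K * K -> R) (C delta eta : R) :
  0 <= eta -> (forall j k, (s j - s k) ^+ 2 <= C) -> (G D <= delta%:E)%E ->
  C * delta *+ 2 <= eta ^+ 2 ->
  (knorm G (lift_kernel (a \o fst) s \- lift_kernel (b \o snd) s)%R <= eta%:E)%E.
Proof.
move=> eta0 sC GD Cd; apply: knorm_le => //.
have maf := label_measurable_comp (@measurable_fst _ _ E F) ma.
have mbf := label_measurable_comp (@measurable_snd _ _ E F) mb.
have GDf : G D \is a fin_num by exact: fin_num_measure.
have C0 : 0 <= C.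
  by apply: le_trans (sC (a point, a point) (a point, a point)); exact: sqr_ge0.
have mI1 : measurable ((fst : (E * F) * (E * F) -> _) @^-1` D).
  by rewrite -[X in measurable X]setTI; exact: measurable_fst.
have mI2 : measurable ((snd : (E * F) * (E * F) -> _) @^-1` D).
  by rewrite -[X in measurable X]setTI; exact: measurable_snd.
pose phi (z : (E * F) * (E * F)) : R := C * (\1_(fst @^-1` D) z + \1_(snd @^-1` D) z).
apply: (@le_trans _ _ (\int[(G \x G)%E]_z (phi z)%:E)%E).
  apply: ge0_le_integral => //.
  - by move=> z _; rewrite lee_fin sqr_ge0.
  - apply/measurable_EFinP/measurable_funX/measurable_funB; exact: measurable_lift_label.
  - apply/measurable_EFinP/measurable_funM => //.
    by apply: measurable_funD; apply/measurable_indic.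
  move=> [z z'] _; rewrite lee_fin /phi /lift_kernel/= !indicE.
  rewrite -[_ \in fst @^-1` D]/(z \in D) -[_ \in snd @^-1` D]/(z' \in D).
  have [zD|/negP zD] := boolP (z \in D).
    by apply: (le_trans (sC _ _)); rewrite ler_peMr// lerDl.
  have [zD'|/negP zD'] := boolP (z' \in D).
    by apply: (le_trans (sC _ _)); rewrite ler_peMr// add0r.
  have e x : ~ x \in D -> a x.1 = b x.2.
    by rewrite inE => /negP; rewrite negbK => /eqP.
  by rewrite (e _ zD) (e _ zD') subrr expr0n/= addr0 mulr0.
rewrite /phi; under eq_integral do rewrite EFinM EFinD.
rewrite ge0_integralZl//; last 2 first.
- by apply: emeasurable_funD; apply/measurable_EFinP/measurable_indic.
- by move=> z _; rewrite -EFinD lee_fin addr_ge0.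
rewrite ge0_integralD//; last 2 first.
- by apply/measurable_EFinP/measurable_indic.
- by apply/measurable_EFinP/measurable_indic.
rewrite !integral_indic// !setIT.
rewrite [X in (_ * (X + _))%E](_ : _ = G D); last exact: product_measure_fst.
rewrite [X in (_ * (_ + X))%E](_ : _ = G D); last exact: product_measure_snd.
rewrite -(fineK GDf) -EFinD -EFinM lee_fin (le_trans _ Cd)//.
rewrite -mulr2n mulrnAr lerMn2r/= ler_wpM2l//.
by rewrite -lee_fin fineK.
Qed.

(** From [f] to its step kernel, across the label mismatch, and from the step kernel to [g]: the
    bound lists these three errors in order. *)
Lemma knorm_label_close (s : K * K -> R) (f : E * E -> R) (g : F * F -> R)
    (C delta eta eps : R) :
  measurable_fun setT f -> measurable_fun setT g ->
  (knorm P (f \- lift_kernel a s)%R <= eps%:E)%E ->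
  (knorm Q (g \- lift_kernel b s)%R <= eps%:E)%E ->
  0 <= eta -> (forall j k, (s j - s k) ^+ 2 <= C) -> (G D <= delta%:E)%E ->
  C * delta *+ 2 <= eta ^+ 2 ->
  (knorm G (lift_kernel fst f \- lift_kernel snd g)%R <= (eps + eta + eps)%:E)%E.
Proof.
move=> mf mg fs gs eta0 sC GD Cd.
have maf := label_measurable_comp (@measurable_fst _ _ E F) ma.
have mbf := label_measurable_comp (@measurable_snd _ _ E F) mb.
have mfs := measurable_lift_label s maf.
have mgs := measurable_lift_label s mbf.
have mlf := measurable_lift_kernel (@measurable_fst _ _ E F) mf.
have mlg := measurable_lift_kernel (@measurable_snd _ _ E F) mg.
apply: (le_trans (knorm_triangle G mlf mgs mlg)).
rewrite EFinD; apply: leeD.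
  apply: (le_trans (knorm_triangle G mlf mfs mgs)); rewrite EFinD; apply: leeD.
    rewrite -[leLHS](knorm_lift (@measurable_fst _ _ E F) GP) in fs => //.
    by apply: measurable_funB => //; exact: measurable_lift_label.
  exact: knorm_label_mismatch sC GD Cd.
rewrite knormBC.
rewrite -[leLHS](knorm_lift (@measurable_snd _ _ E F) GQ) in gs => //.
by apply: measurable_funB => //; exact: measurable_lift_label.
Qed.

End label_closeness.

(** * Approximation of kernels by step kernels *)

Section step_approximation.
Context (R : realType) (d : measure_display) (E : measurableType d)
  (P : probability E R).
Implicit Types f g h : E * E -> R.
Import HBNNSimple.

(** A single labelling serves both arguments of the kernel, so that a coupling acts on it through
    the labels of points alone. *)
Definition step_approximable f := forall e : R, 0 < e ->
  exists (K : finType) (a : E -> K) (s : K * K -> R),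
    label_measurable a /\ (knorm P (f \- lift_kernel a s)%R <= e%:E)%E.

Lemma step_approximable_lift (K : finType) (a : E -> K) (s : K * K -> R) :
  label_measurable a -> step_approximable (lift_kernel a s).
Proof.
move=> ma e e0; exists K, a, s; split=> //.
rewrite (_ : (_ \- _)%R = cst 0) ?knorm_cst ?normr0 ?lee_fin ?ltW//.
by apply/funext => z /=; rewrite subrr.
Qed.

Lemma step_approximable_cst (c : R) : step_approximable (cst c).
Proof.
have -> : cst c = lift_kernel (fun _ : E => tt) (cst c) by [].
apply: step_approximable_lift => -[].
by rewrite (_ : _ @^-1` _ = setT)//; apply/seteqP; split.
Qed.

Lemma step_approximable_closed f : measurable_fun setT f ->
  (forall e : R, 0 < e -> exists g, [/\ measurable_fun setT g, step_approximable g &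
    (knorm P (f \- g)%R <= e%:E)%E]) ->
  step_approximable f.
Proof.
move=> mf fg e e0; have e20 : 0 < e / 2 by rewrite divr_gt0.
have [g [mg ag fge]] := fg _ e20; have [K [a [s [ma gs]]]] := ag _ e20.
exists K, a, s; split=> //.
have ms := measurable_lift_label s ma.
apply: (le_trans (knorm_triangle P mf mg ms)).
by rewrite [e]splitr EFinD; exact: leeD.
Qed.

Lemma step_approximableD f g : measurable_fun setT f -> measurable_fun setT g ->
  step_approximable f -> step_approximable g -> step_approximable (f \+ g)%R.
Proof.
move=> mf mg af ag e e0; have e20 : 0 < e / 2 by rewrite divr_gt0.
have [K [a [s [ma fs]]]] := af _ e20; have [L [b [t [mb gt]]]] := ag _ e20.
exists (K * L)%type, (fun x => (a x, b x)).
exists (fun z => s (z.1.1, z.2.1) + t (z.1.2, z.2.2)); split.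
  move=> [j k]; rewrite (_ : _ @^-1` _ = (a @^-1` [set j]) `&` (b @^-1` [set k])).
    exact: measurableI.
  by apply/seteqP; split=> [x [<- <-]//|x [/= <- <-]].
have ms := measurable_lift_label s ma; have mt := measurable_lift_label t mb.
rewrite (_ : (_ \- _)%R = (f \- lift_kernel a s) \+ (g \- lift_kernel b t)); last first.
  by apply/funext => z /=; rewrite /lift_kernel/=; ring.
apply: (le_trans (knormD P _ _)); [exact: measurable_funB|exact: measurable_funB|].
by rewrite [e]splitr EFinD; exact: leeD.
Qed.

Lemma step_approximableZ (c : R) f : measurable_fun setT f ->
  step_approximable f -> step_approximable (fun z => c * f z).
Proof.
move=> mf af e e0; have c0 : 0 < `|c| + 1 by rewrite ltr_wpDl.
have [K [a [s [ma fs]]]] := af _ (divr_gt0 e0 c0).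
exists K, a, (fun z => c * s z); split=> //.
have ms := measurable_lift_label s ma.
rewrite (_ : (_ \- _)%R = fun z => c * (f \- lift_kernel a s)%R z); last first.
  by apply/funext => z /=; rewrite /lift_kernel/=; ring.
rewrite knormZ; last exact: measurable_funB.
apply: (@le_trans _ _ (`|c|%:E * (e / (`|c| + 1))%:E)%E).
  by apply: lee_wpmul2l => //; rewrite lee_fin.
by rewrite -EFinM lee_fin mulrCA ger_pMr// ler_pdivrMr// mul1r lerDl.
Qed.

Lemma step_approximableB f g : measurable_fun setT f -> measurable_fun setT g ->
  step_approximable f -> step_approximable g -> step_approximable (f \- g)%R.
Proof.
move=> mf mg af ag; rewrite (_ : (f \- g)%R = f \+ (fun z => -1 * g z)).
  apply: step_approximableD => //; last exact: step_approximableZ.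
  exact: measurable_funM.
by apply/funext => z /=; rewrite mulN1r.
Qed.

Lemma step_approximable_sum n (F : 'I_n -> E * E -> R) :
  (forall i, measurable_fun setT (F i)) -> (forall i, step_approximable (F i)) ->
  step_approximable (fun z => \sum_(i < n) F i z).
Proof.
elim: n F => [|n IH] F mF aF.
  rewrite (_ : (fun _ => _) = cst 0); first exact: step_approximable_cst.
  by apply/funext => z; rewrite big_ord0.
rewrite (_ : (fun _ => _) = (fun z => \sum_(i < n) F (widen_ord (leqnSn n) i) z) \+ F ord_max).
  apply: step_approximableD => //; last exact: IH.
  exact: measurable_sum.
by apply/funext => z; rewrite big_ord_recr.
Qed.

(** A Dynkin class argument. The indicator of a rectangle is a step kernel, the label recording
    membership in each of the two sides; proper differences are handled by linearity and increasing
    unions by L^2 approximation. *)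
Lemma step_approximable_indic (C : set (E * E)) : measurable C ->
  step_approximable (\1_C).
Proof.
pose H := [set C : set (E * E) | measurable C /\ step_approximable (\1_C)].
suff : measurable `<=` H by move=> /[apply] -[].
rewrite measurable_prod_measurableType.
apply: lambda_system_subset => //.
- move=> _ _ [A mA [B mB <-]] [A' mA' [B' mB' <-]]; rewrite -setXI.
  by exists (A `&` A'); [exact: measurableI|exists (B `&` B') => //; exact: measurableI].
- split=> //.
  + split=> //; rewrite indicT; exact: step_approximable_cst.
  + move=> A B BA [mA aA] [mB aB]; split; first exact: measurableD.
    rewrite (_ : \1_ _ = (\1_A \- \1_B)%R :> (E * E -> R)).
      by apply: step_approximableB => //; exact: measurable_indic.
    apply/funext => z /=; rewrite !indicE in_setD.
    have [zB|zB] := boolP (z \in B); last by rewrite andbT subr0.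
    have -> : z \in A by rewrite inE; apply: BA; rewrite inE in zB.
    by rewrite subrr.
  + move=> F ndF HF; have mF i : measurable (F i) by have [] := HF i.
    have mUF : measurable (\bigcup_i F i) by exact: bigcup_measurable.
    split=> //; apply: step_approximable_closed => [|e e0]; first exact: measurable_indic.
    pose PP : probability (E * E)%type R := (P \x P)%E.
    have muF := @nondecreasing_cvg_mu _ _ _ PP F mF mUF ndF.
    have PUF : PP (\bigcup_i F i) \is a fin_num by exact: fin_num_measure.
    have PF n : PP (F n) \is a fin_num by exact: fin_num_measure.
    have : \forall n \near \oo, (PP (\bigcup_i F i) - (e ^+ 2)%:E < PP (F n))%E.
      apply: (muF _ (open_ereal_gt' _)).
      by rewrite lteBlDr// lteDl// lte_fin exprn_gt0.
    move=> [n _ /(_ n (leqnn n)) PFn]; exists (\1_(F n)).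
    split; [exact: measurable_indic|by have [] := HF n|].
    apply: knorm_le; first exact: ltW.
    have Fn : F n `<=` \bigcup_i F i by exact: bigcup_sup.
    (* The squared difference of the two indicators is the indicator of what [F n] misses, a set of
       mass below [e ^+ 2]. *)
    rewrite (_ : (\int[_]_z _ = \int[(P \x P)%E]_z (\1_((\bigcup_i F i) `\` F n) z)%:E)%E); last first.
      apply: eq_integral => z _; congr (_%:E); rewrite /= !indicE in_setD.
      have [zB|zB] := boolP (z \in F n); last by rewrite andbT subr0; case: (_ \in _); rewrite ?expr0n ?expr1n.
      have -> : z \in \bigcup_i F i by rewrite inE; apply: Fn; rewrite inE in zB.
      by rewrite subrr expr0n.
    rewrite integral_indic//; last exact: measurableD.
    rewrite setIT -[leLHS]/(PP (_ `\` _)) measureD//= ?setIidr//; last by rewrite ltey_eq PUF.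
    by rewrite -[leLHS]/(PP (\bigcup_i F i) - PP (F n))%E leeBlDr// addeC -leeBlDr// ltW.
move=> _ [A mA [B mB <-]]; split; first exact: measurableX.
rewrite (_ : \1_ _ = lift_kernel (fun x : E => (x \in A, x \in B))
    (fun z => (z.1.1 && z.2.2)%:R : R)); last first.
  by apply/funext => z; rewrite /lift_kernel/= indicE in_setX.
apply: step_approximable_lift => -[p q].
rewrite (_ : _ @^-1` _ = (if p then A else ~` A) `&` (if q then B else ~` B)).
  by apply: measurableI; case: ifP => _ //; exact: measurableC.
apply/seteqP; split=> [x [<- <-]|x /= [xA xB]].
  by split; case: ifPn => /=; rewrite ?inE// notin_setE.
congr pair.
  by case: p xA => xA; [exact: mem_set|exact: memNset].
by case: q xB => xB; [exact: mem_set|exact: memNset].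
Qed.

(** Simple functions increase to [f]; their squared errors are dominated by the integrable [f ^ 2],
    so dominated convergence applies. *)
Lemma step_approximable_ge0 f : measurable_fun setT f -> (forall z, 0 <= f z) ->
  (knorm P f < +oo)%E -> step_approximable f.
Proof.
move=> mf f0 fin_f.
have mEf : measurable_fun setT (EFin \o f) by exact/measurable_EFinP.
have [h [ndh hf]] := @approximation _ _ _ _ measurableT _ mEf (fun z _ => f0 z).
have mh n : measurable_fun setT (h n) by exact: measurable_funP.
have hfz z : (h ^~ z) @ \oo --> f z by have /fine_cvgP[] := hf z I.
have hle n z : h n z <= f z.
  rewrite -(cvg_lim _ (hfz z))//; apply: nondecreasing_cvgn_le; last by apply/cvg_ex; exists (f z).
  by move=> m k mk; exact/(lefP _ _ (ndh _ _ mk)).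
have h0 n z : 0 <= h n z by [].
apply: step_approximable_closed => // e e0.
pose F n z := ((f z - h n z) ^+ 2)%:E.
have mF n : measurable_fun setT (F n).
  by apply/measurable_EFinP; apply: measurable_funX; exact: measurable_funB.
have F0 : {ae (P \x P)%E, forall z, setT z -> F ^~ z @ \oo --> (0 : \bar R)}.
  apply: aeW => z _; apply: cvg_EFin; first by near=> n.
  rewrite -[X in _ --> X](_ : (f z - f z) ^+ 2 = 0); last by rewrite subrr expr0n.
  rewrite /comp/=; under eq_fun do rewrite expr2.
  by apply: cvgM; apply: cvgB => //; exact: cvg_cst.
have If : (P \x P)%E.-integrable setT (fun z => (f z ^+ 2)%:E).
  apply/integrableP; split.
    by apply/measurable_EFinP; exact: measurable_funX.
  under eq_integral do rewrite gee0_abs ?lee_fin ?sqr_ge0//.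
  rewrite -knorm_sqr; case: (knorm P f) fin_f (knorm_ge0 P f) => // r _ _.
  by rewrite -EFin_expe ltry.
have Ff : {ae (P \x P)%E, forall z n, setT z -> `|F n z| <= (f z ^+ 2)%:E}%E.
  apply: aeW => z n _; rewrite gee0_abs ?lee_fin ?sqr_ge0//.
  by rewrite lerXn2r ?nnegrE ?subr_ge0 ?gerBl.
have [_ _ cF] := dominated_convergence measurableT mF (measurable_cst _) F0 If Ff.
rewrite integral0 in cF.
have : \forall n \near \oo, (\int[(P \x P)%E]_z F n z < (e ^+ 2)%:E)%E.
  by apply: (cF _ (open_ereal_lt' _)); rewrite lte_fin exprn_gt0.
move=> [n _ /(_ n (leqnn n)) /= Fn]; exists (h n); split=> //.
  rewrite (funext (fimfunEord (h n))); apply: step_approximable_sum => i.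
    by apply: measurable_funM => //; exact: measurable_indic.
  apply: step_approximableZ; first exact: measurable_indic.
  exact: step_approximable_indic.
by apply: knorm_le; rewrite ltW.
Unshelve. all: end_near. Qed.

Lemma step_approximable_L2 f : measurable_fun setT f ->
  (knorm P f < +oo)%E -> step_approximable f.
Proof.
move=> mf fin_f.
have mp : measurable_fun setT (f ^\+)%R by exact: measurable_funrpos.
have mn : measurable_fun setT (f ^\-)%R by exact: measurable_funrneg.
rewrite -(funrposBneg f); apply: step_approximableB => //.
- apply: step_approximable_ge0 => //.
  apply: le_lt_trans fin_f; apply: le_knorm => // z.
  by rewrite /funrpos ger0_norm ?le_max ?lexx ?orbT// ge_max ler_norm normr_ge0.
- apply: step_approximable_ge0 => //.
  apply: le_lt_trans fin_f; apply: le_knorm => // z.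
  by rewrite /funrneg ger0_norm ?le_max ?lexx ?orbT// ge_max -normrN ler_norm normr_ge0.
Qed.

End step_approximation.

(** * The triangle inequality for the Gromov-Wasserstein distance *)

Lemma label_oscillation_bound (R : realType) (K : finType) (s : K -> R) :
  exists C, forall j k, (s j - s k) ^+ 2 <= C.
Proof.
exists (\sum_(jk : K * K) (s jk.1 - s jk.2) ^+ 2) => j k.
by rewrite (bigD1 (j, k))//= lerDl sumr_ge0// => i _; exact: sqr_ge0.
Qed.

(* Gluing the two couplings exactly would need a disintegration; it is enough to
   couple them so that both copies of the middle variable lie in the same cell
   of a finite partition on which the middle gauge is nearly a step kernel. *)
Lemma GW_triangle (R : realType) (X Y Z : gmSpace R) :
  (GW X Z <= GW X Y + GW Y Z)%E.
Proof.
(* Four errors of [e / 4]: two near-optimal couplings, and the step approximation of each copy of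
   the middle gauge. *)
apply/lee_addgt0Pr => e e0; have e4 : 0 < e / 4 by rewrite divr_gt0.
have [p1 [p1X p1Y] p1e] := GW_adherent X Y e4.
have [p2 [p2Y p2Z] p2e] := GW_adherent Y Z e4.
have [K [a [s [ma gs]]]] :=
  step_approximable_L2 (measurable_gauge Y) (knorm_gauge_lty Y) e4.
have [C sC] := label_oscillation_bound s.
have ma1 := label_measurable_comp (@measurable_snd _ _ (borel X) (borel Y)) ma.
have ma2 := label_measurable_comp (@measurable_fst _ _ (borel Y) (borel Z)) ma.
pose q j : R := fine (gm_measure Y (a @^-1` [set j])).
have qE j : gm_measure Y (a @^-1` [set j]) = (q j)%:E.
  by rewrite fineK// fin_num_measure//; exact: ma.
(* This mass table sits on the diagonal: both copies of the middle variable almost surely have the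
   same label, so the mismatch is 0. *)
pose w j k : R := if j == k then q j else 0.
have w0 j k : 0 <= w j k by rewrite /w; case: ifP => // _; exact: fine_ge0.
have Pw j : p1 ((a \o snd) @^-1` [set j]) = (\sum_k w j k)%:E.
  rewrite -big_mkcond/= (eq_bigl (pred1 j)) ?big_pred1_eq; last by move=> k; rewrite eq_sym.
  by rewrite -qE -p1Y//; exact: ma.
have Qw k : p2 ((a \o fst) @^-1` [set k]) = (\sum_j w j k)%:E.
  rewrite /w -big_mkcond/= big_pred1_eq.
  by rewrite -qE -p2Y//; exact: ma.
have [G [G1 G2 Gw]] := label_coupling ma1 ma2 w0 Pw Qw.
have GD := label_mismatch ma1 ma2 Gw.
rewrite big1 in GD; last by move=> jk /negbTE; rewrite /w => ->.
have mgX := measurable_gauge X; have mgY := measurable_gauge Y.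
have mgZ := measurable_gauge Z.
have mX := measurable_lift_kernel (@measurable_fst _ _ (borel X) (borel Y)) mgX.
have mY := measurable_lift_kernel (@measurable_snd _ _ (borel X) (borel Y)) mgY.
have mY' := measurable_lift_kernel (@measurable_fst _ _ (borel Y) (borel Z)) mgY.
have mZ := measurable_lift_kernel (@measurable_snd _ _ (borel Y) (borel Z)) mgZ.
have mf1 := @measurable_fst _ _ (borel X * borel Y)%type (borel Y * borel Z)%type.
have mf2 := @measurable_snd _ _ (borel X * borel Y)%type (borel Y * borel Z)%type.
have mD := measurable_funB mgY (measurable_lift_label s ma).
have mid : (knorm G (lift_kernel fst (lift_kernel snd (@gm_gauge R Y)) \-
    lift_kernel snd (lift_kernel fst (@gm_gauge R Y)))%R <= (e / 4 + 0 + e / 4)%:E)%E.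
  apply: (knorm_label_close ma1 ma2 G1 G2 mY mY' (s := s) (C := C) (delta := 0)) => //.
  - by rewrite -(knorm_lift (@measurable_snd _ _ (borel X) (borel Y)) p1Y mD) in gs.
  - by rewrite -(knorm_lift (@measurable_fst _ _ (borel Y) (borel Z)) p2Y mD) in gs.
  - by rewrite GD.
  - by rewrite mulr0 mul0rn expr0n.
have G1X : is_pushforward G (fst \o fst) (gm_measure X).
  by apply/(is_pushforward_comp _ measurable_fst G1).
have G2Z : is_pushforward G (snd \o snd) (gm_measure Z).
  by apply/(is_pushforward_comp _ measurable_snd G2).
apply: (le_trans (GW_le (measurableT_comp measurable_fst mf1)
  (measurableT_comp measurable_snd mf2) G1X G2Z)).
have mX2 := measurable_lift_kernel mf1 mX.
have mY2 := measurable_lift_kernel mf1 mY.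
have mY'2 := measurable_lift_kernel mf2 mY'.
have mZ2 := measurable_lift_kernel mf2 mZ.
apply: (le_trans (knorm_triangle G mX2 mY2 mZ2)).
rewrite -[X in (X + _)%E]/(knorm G (lift_kernel fst (_ \- _)%R)).
rewrite (knorm_lift mf1 G1 (measurable_funB mX mY)) -GWfunE.
apply: (@le_trans _ _ ((GW X Y + (e / 4)%:E) + ((e / 4 + 0 + e / 4)%:E + (GW Y Z + (e / 4)%:E)))%E).
  apply: leeD; first exact: ltW.
  apply: (le_trans (knorm_triangle G mY2 mY'2 mZ2)); apply: leeD => //.
  rewrite -[leLHS]/(knorm G (lift_kernel snd (_ \- _)%R)).
  by rewrite (knorm_lift mf2 G2 (measurable_funB mY' mZ)) -GWfunE ltW.
rewrite -(fineK (GW_fin_num X Y)) -(fineK (GW_fin_num Y Z)) -!EFinD lee_fin.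
lra.
Qed.

(** * Homomorphism classes and their distance *)

Section homomorphism_classes.
Context (R : realType).
Implicit Types (X Y Z : gmSpace R) (x y : GM R).

Lemma GW_congr_l X Y Z : GW X Y = 0%E -> GW X Z = GW Y Z.
Proof.
move=> XY; apply/eqP; rewrite eq_le; apply/andP; split.
  by rewrite (le_trans (GW_triangle X Y Z))// XY add0e.
by rewrite (le_trans (GW_triangle Y X Z))// GW_sym XY add0e.
Qed.

Lemma GM_mem_GW0 x X Y : x X -> x Y -> GW X Y = 0%E.
Proof.
have [W ->] := gm_classP x => WX WY.
by rewrite -(GW_congr_l Y WX).
Qed.

Lemma GMrepr_mem x : x (GMrepr x).
Proof. by rewrite /GMrepr; case: cid => X /= ->; exact: GW_xx. Qed.

Lemma toGM_mem X : toGM X X.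
Proof. exact: GW_xx. Qed.

Lemma GWdistE x y X Y : x X -> y Y -> GWdist x y = GW X Y.
Proof.
move=> xX yY; rewrite /GWdist (GW_congr_l _ (GM_mem_GW0 (GMrepr_mem x) xX)).
by rewrite GW_sym (GW_congr_l _ (GM_mem_GW0 (GMrepr_mem y) yY)) GW_sym.
Qed.

End homomorphism_classes.

(** * Energy descent along tangential barycenters *)

(** The parallel axis identity: the cross term vanishes because the weighted deviations from the
    mean [m] sum to 0. *)
Lemma variance_decomposition (R : realType) (N : nat) (rho : 'I_N -> R)
    (g : 'I_N -> R) (h : R) : \sum_i rho i = 1 ->
  \sum_i rho i * (h - g i) ^+ 2 =
  (h - \sum_i rho i * g i) ^+ 2 + \sum_i rho i * (\sum_i rho i * g i - g i) ^+ 2.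
Proof.
move=> rho1; set m := \sum_i rho i * g i.
have m0 : \sum_i rho i * (m - g i) = 0.
  under eq_bigr do rewrite mulrBr.
  by rewrite big_split/= -mulr_suml rho1 mul1r sumrN subrr.
rewrite -[X in X + _]mul1r -rho1 mulr_suml -big_split/=.
(* The vanishing cross term is added on the right, after which the identity holds summand by
   summand. *)
rewrite -[RHS]addr0 -[X in _ = _ + X](mulr0 (2 * (h - m))) -[X in _ = _ + _ * X]m0 mulr_sumr -big_split/=.
by apply: eq_bigr => i _; ring.
Qed.

(** [a] decreases and is bounded below, so its decrements, which dominate [b], tend to 0. *)
Lemma cvg_gap0 (R : realType) (a b : nat -> R) :
  (forall n, 0 <= a n) -> (forall n, 0 <= b n) ->
  (forall n, a n.+1 + b n <= a n) -> b @ \oo --> 0.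
Proof.
move=> a0 b0 ab.
have nia : nonincreasing_seq a.
  by apply/nonincreasing_seqP => n; apply: le_trans (ab n); rewrite lerDl.
have /cvg_ex[l al] : cvgn a.
  apply: nonincreasing_is_cvgn => //.
  by exists 0 => _ [n _ <-].
apply: (@squeeze_cvgr _ _ _ _ (cst 0) (fun n => a n - a n.+1)).
- by apply: nearW => n; rewrite b0/= lerBrDl.
- exact: cvg_cst.
- rewrite -(subrr l); apply: cvgB => //.
  by rewrite (cvg_shiftS a).
Qed.

Section energy_descent.
Context (R : realType) (N : nat) (X : 'I_N -> gmSpace R) (rho : 'I_N -> R).
Hypothesis Hrho : simplex rho.
Implicit Types Y : gmSpace R.

Let rho0 i : 0 <= rho i. Proof. by case: Hrho => /(_ i)/andP[]. Qed.

(** A gluing is specified only through its marginals on [Y] times a factor, so its marginal on [Y]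
    has to be read off some factor. *)
Lemma simplex_index : 'I_N.
Proof.
have : (0 < N)%N.
  rewrite lt0n; apply/eqP => N0; case: Hrho => _; rewrite big1 => [/eqP|i _].
    by rewrite eq_sym oner_eq0.
  by move: (leq_ltn_trans (leq0n i) (ltn_ord i)); rewrite lt0n => /eqP/(_ N0).
by move=> N0; exact: (Ordinal N0).
Qed.

Definition factor i (x : borel (prod_space X)) : borel (X i) := x i.

Lemma measurable_factor i : measurable_fun setT (factor i).
Proof. exact: measurable_proj. Qed.
Hint Resolve measurable_factor : core.

Lemma has_marginalsP (mu : probability (borel (prod_space X)) R) i :
  has_marginals X mu -> is_pushforward mu (factor i) (gm_measure (X i)).
Proof. by move=> muX; exact: muX. Qed.

Lemma measurable_lift_factor i : measurable_fun setT
  (lift_kernel (factor i) (@gm_gauge R (X i))).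
Proof. apply: measurable_lift_kernel => //; exact: measurable_gauge. Qed.
Hint Resolve measurable_lift_factor : core.

Lemma measurable_prod_gauge : measurable_fun setT (@prod_gauge R N X rho).
Proof.
apply: measurable_sum => i; apply: measurable_funM => //.
exact: measurable_lift_factor.
Qed.

(** The gluing is a common probability space for [Y] and all the [X i]; the coupling it induces with
    [X i] is the optimal [pi i], hence the equality of costs. *)
Lemma opt_melting_gluing Y mu : opt_melting Y X mu ->
  exists G : probability (borel Y * borel (prod_space X))%type R,
  [/\ is_pushforward G fst (gm_measure Y), is_pushforward G snd mu &
   forall i, knorm G (lift_kernel fst (@gm_gauge R Y) \-
     lift_kernel (factor i \o snd) (@gm_gauge R (X i)))%R = GW Y (X i)].
Proof.
move=> muO; have muX := opt_melting_marginals muO.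
case: muO => pi piO [G Gpi Gmu]; exists G.
have G1 : is_pushforward G fst (gm_measure Y).
  have [[piY _] _] := piO simplex_index.
  by apply/(is_pushforward_comp _ measurable_fst (Gpi simplex_index)).
split=> // i; have [[piY piX] piopt] := piO i.
have mi : measurable_fun setT
    (factor i \o snd : borel Y * borel (prod_space X) -> borel (X i)).
  exact: measurableT_comp.
have GXi : is_pushforward G (factor i \o snd) (gm_measure (X i)).
  have := (is_pushforward_comp (gm_measure (X i)) (@measurable_factor i) Gmu).
  by case => + _; apply; exact: muX.
rewrite -(GWfun_pushforward measurable_fst mi (Gpi i)).
apply/eqP; rewrite eq_le; apply/andP; split.
  by apply: le_ereal_inf_tmp => _ [pi' cpi' <-]; exact: piopt.
by apply: ereal_inf_lbound; exists (pi i) => //; have [] := piO i.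
Qed.

(** The functional that Gromov-Wasserstein barycenters minimize. *)
Definition energy Y : R := \sum_i rho i * fine (GW Y (X i)) ^+ 2.

Lemma energy_ge0 Y : 0 <= energy Y.
Proof. by apply: sumr_ge0 => i _; rewrite mulr_ge0// sqr_ge0. Qed.

Section descent.
Variables (Y : gmSpace R) (mu : probability (borel (prod_space X)) R).
Variable G : probability (borel Y * borel (prod_space X))%type R.
Hypothesis muX : has_marginals X mu.
Hypothesis G1 : is_pushforward G fst (gm_measure Y).
Hypothesis G2 : is_pushforward G snd mu.
Hypothesis GGW : forall i, knorm G (lift_kernel fst (@gm_gauge R Y) \-
     lift_kernel (factor i \o snd) (@gm_gauge R (X i)))%R = GW Y (X i).

Let h := lift_kernel (fst : borel Y * borel (prod_space X) -> _) (@gm_gauge R Y).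
Let g i := lift_kernel
  (factor i \o snd : borel Y * borel (prod_space X) -> _) (@gm_gauge R (X i)).
Let m := lift_kernel (snd : borel Y * borel (prod_space X) -> _) (@prod_gauge R N X rho).

Let mh : measurable_fun setT h.
Proof. by apply: measurable_lift_kernel => //; exact: measurable_gauge. Qed.
Let mg i : measurable_fun setT (g i).
Proof.
apply: measurable_lift_kernel; last exact: measurable_gauge.
exact: measurableT_comp.
Qed.
Let mm : measurable_fun setT m.
Proof. by apply: measurable_lift_kernel => //; exact: measurable_prod_gauge. Qed.

Lemma GW_melting_le : (GW Y (melting_space rho muX) <= knorm G (h \- m)%R)%E.
Proof. exact: (@GW_le _ _ (melting_space rho muX)). Qed.

Lemma knorm_melting_lty : (knorm G (h \- m)%R < +oo)%E.
Proof.
apply: (le_lt_trans (@knorm_coupling_le _ _ (melting_space rho muX) _ _ _ _ _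
  measurable_fst measurable_snd G1 G2)).
by rewrite lte_add_pinfty// knorm_gauge_lty.
Qed.

Lemma energy_descent :
  energy (melting_space rho muX) + fine (knorm G (h \- m)%R) ^+ 2 <= energy Y.
Proof.
have msq (f : (borel Y * borel (prod_space X)) * (borel Y * borel (prod_space X)) -> R) :
    measurable_fun setT f -> measurable_fun setT (fun z => (f z ^+ 2)%:E : \bar R).
  by move=> mf; apply/measurable_EFinP; exact: measurable_funX.
have sum_int (f : 'I_N -> (borel Y * borel (prod_space X)) * (borel Y * borel (prod_space X)) -> R) : (forall i, measurable_fun setT (f i)) ->
   (\int[(G \x G)%E]_z (\sum_i rho i * f i z ^+ 2)%:E =
    \sum_i (rho i)%:E * knorm G (f i) ^+ 2)%E.
  move=> mf; under eq_integral do rewrite -sumEFin.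
  rewrite ge0_integral_sum//; last 2 first.
  - by move=> i; apply/measurable_EFinP/measurable_funM => //; exact: measurable_funX.
  - by move=> i z _; rewrite lee_fin mulr_ge0// sqr_ge0.
  apply: eq_bigr => i _; under eq_integral do rewrite EFinM.
  rewrite ge0_integralZl//.
  - by rewrite knorm_sqr.
  - exact: msq.
  - by move=> z _; rewrite lee_fin sqr_ge0.
  - by rewrite lee_fin.
(* The variance identity, integrated. All terms are nonnegative, so it holds in the extended reals
   without integrability conditions. *)
have : (\sum_i (rho i)%:E * knorm G (h \- g i)%R ^+ 2 =
    knorm G (h \- m)%R ^+ 2 + \sum_i (rho i)%:E * knorm G (m \- g i)%R ^+ 2)%E.
  rewrite -!sum_int => [|i|i]; try exact: measurable_funB.
  rewrite knorm_sqr -ge0_integralD//.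
  - apply: eq_integral => z _; rewrite -EFinD /= variance_decomposition//.
    by case: Hrho.
  - by move=> z _; rewrite lee_fin sqr_ge0.
  - by apply: msq; exact: measurable_funB.
  - by move=> z _; rewrite lee_fin sumr_ge0// => i _; rewrite mulr_ge0// sqr_ge0.
  - apply/measurable_EFinP/measurable_sum => i; apply: measurable_funM => //.
    by apply: measurable_funX; exact: measurable_funB.
(* Only here does optimality of the couplings enter. *)
have -> : (\sum_i (rho i)%:E * knorm G (h \- g i)%R ^+ 2 = (energy Y)%:E)%E.
  rewrite /energy -sumEFin; apply: eq_bigr => i _.
  by rewrite GGW EFinM EFin_expe fineK// GW_fin_num.
rewrite -lee_fin => ->; rewrite EFinD EFin_expe fineK; last first.
  by rewrite ge0_fin_numE ?knorm_ge0// knorm_melting_lty.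
rewrite addeC; apply: leeD => //; rewrite /energy -sumEFin; apply: lee_sum => i _.
rewrite EFinM EFin_expe fineK ?GW_fin_num//.
apply: lee_wpmul2l; first by rewrite lee_fin.
(* For the melting an inequality remains: [G] couples it with [X i], but not necessarily
   optimally. *)
rewrite lee_sqr ?GW_ge0 ?knorm_ge0//.
have GXi : is_pushforward G (factor i \o snd) (gm_measure (X i)).
  have := (is_pushforward_comp (gm_measure (X i)) (@measurable_factor i) G2).
  by case => + _; apply; exact: muX.
apply: (@GW_le _ (melting_space rho muX)) => //.
exact: measurableT_comp.
Qed.

End descent.
End energy_descent.

(** * Regularity of Borel probabilities on Polish spaces *)

Section sigma_small_errors.
Context (R : realType) (d : measure_display) (E : measurableType d)
  (P : probability E R).

(** A point of all the [A n] that misses some [F n] lies in that [A n] minus [F n]; the errors form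
    a geometric series of sum [e]. *)
Lemma measure_bigcapD_le (A F : nat -> set E) (e : R) : 0 <= e ->
  (forall n, measurable (A n)) -> (forall n, measurable (F n)) ->
  (forall n, P (A n `\` F n) <= (e / (2 ^ n.+1)%:R)%:E)%E ->
  (P ((\bigcap_n A n) `\` (\bigcap_n F n)) <= e%:E)%E.
Proof.
move=> e0 mA mF AF; apply: (le_trans _ (epsilon_trick0 xpredT e0)).
apply: (@le_trans _ _ (\sum_(n <oo) P (A n `\` F n))%E).
  apply: measure_sigma_subadditive.
  - by move=> n; exact: measurableD.
  - by apply: measurableD; exact: bigcapT_measurable.
  - move=> x [Ax /existsNP[n /not_implyP[_ nF]]]; exists n => //; split=> //; exact: Ax.
by apply: lee_nneseries => n _ *; [exact: measure_ge0|exact: AF].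
Qed.

Lemma measure_bigcup_inner (F : nat -> set E) (A : set E) (e : R) : 0 < e ->
  (forall n, measurable (F n)) -> nondecreasing_seq F -> A = \bigcup_n F n ->
  exists n, (P (A `\` F n) <= e%:E)%E.
Proof.
move=> e0 mF ndF ->; have mU : measurable (\bigcup_n F n) by exact: bigcup_measurable.
have PU : P (\bigcup_n F n) \is a fin_num by exact: fin_num_measure.
have PF n : P (F n) \is a fin_num by exact: fin_num_measure.
have cv := nondecreasing_cvg_mu mF mU ndF : P \o F @ \oo --> _.
have lt : (P (\bigcup_n F n) - e%:E < P (\bigcup_n F n))%E by rewrite lteBlDr// lteDl// lte_fin.
have [n _ /(_ n (leqnn n)) Fn] := cv _ (open_ereal_gt' lt).
exists n; rewrite measureD//; last by rewrite ltey_eq PU.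
rewrite setIidr; last exact: bigcup_sup.
rewrite leeBlDr//; last exact: PF.
by rewrite -leeBlDl// ltW.
Qed.

End sigma_small_errors.

Lemma separable_dense_seq (T : ptopologicalType) : separable T ->
  exists s : nat -> T, dense (range s).
Proof.
move=> [S cS dS]; have [x [_ Sx]] := dS [set: T] (ex_intro _ point I) openT.
have /pfcard_geP[S0|[s]] : (S #<= [set: nat])%card by exact: cS.
  by rewrite S0 in Sx.
by exists s; rewrite image_eq.
Qed.

Section polish_regularity.
Context (R : realType) (T : ptopologicalType) (dist : T -> T -> R).
Hypothesis dM : is_metric dist.
Hypothesis dT : induces_topology dist.
Implicit Types (x y : T) (A : set T).

Let d0 x : dist x x = 0. Proof. by case: dM => /(_ x x)[_ ->]. Qed.
Let dC x y : dist x y = dist y x. Proof. by case: dM. Qed.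
Let dD x y z : dist x z <= dist x y + dist y z. Proof. by case: dM. Qed.

Lemma metric_openP A :
  open A <-> forall x, A x -> exists2 e : R, 0 < e & [set y | dist x y < e] `<=` A.
Proof.
rewrite openE; split=> [oA x Ax|oA x Ax]; first by apply/dT; exact: oA.
by apply/dT; exact: oA.
Qed.

Lemma closed_metric_ball x (e : R) : closed [set y | dist x y <= e].
Proof.
rewrite -openC; apply/metric_openP => y /negP.
rewrite -ltNge => xy; exists (dist x y - e); first by rewrite subr_gt0.
move=> z /= yz; apply/negP; rewrite -ltNge.
have := dD x z y; rewrite (dC z y); lra.
Qed.

Lemma open_borel_measurable A : open A -> measurable (A : set (borel T)).
Proof. exact: sub_sigma_algebra. Qed.

Lemma closed_borel_measurable A : closed A -> measurable (A : set (borel T)).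
Proof.
move=> cA; suff : measurable (~` A : set (borel T)) by move=> /measurableC; rewrite setCK.
by apply: open_borel_measurable; rewrite openC.
Qed.

Variable P : probability (borel T) R.

Definition closed_inner_regular A := forall e : R, 0 < e ->
  exists F, [/\ closed F, F `<=` A & (P (A `\` F) <= e%:E)%E].

Lemma open_closed_inner_regular A : open A -> closed_inner_regular A.
Proof.
move=> oA e e0.
(* Points at distance at least 1/(n+1) from the complement of [A]; the quantified form also covers
   an empty complement. *)
pose F n := [set x | forall y, ~ A y -> n.+1%:R^-1 <= dist x y].
have cF n : closed (F n).
  rewrite -openC; apply/metric_openP => x.
  move=> /existsNP[y /not_implyP[nAy /negP]]; rewrite -ltNge => xy.
  exists (n.+1%:R^-1 - dist x y); first by rewrite subr_gt0.
  move=> z /= xz /(_ y nAy); apply/negP; rewrite -ltNge.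
  by rewrite (le_lt_trans (dD z x y))// (dC z x) -ltrBrDr.
have mF n : measurable (F n : set (borel T)) by exact: closed_borel_measurable.
have ndF : nondecreasing_seq (F : nat -> set (borel T)).
  move=> m n mn; apply/subsetPset => x Fx y nAy; apply: le_trans (Fx y nAy).
  by rewrite lef_pV2 ?posrE// ler_nat.
have AF : A = \bigcup_n F n.
  apply/seteqP; split=> x; last first.
    move=> [n _ Fx]; apply: contrapT => /(Fx _); rewrite d0.
    by apply/negP; rewrite -ltNge invr_gt0.
  move=> /((metric_openP A).1 oA) [r r0 rA].
  have [n nr] : exists n, n.+1%:R^-1 < r.
    by have [n _ /(_ n (leqnn n))] := near_infty_natSinv_lt (PosNum r0); exists n.
  exists n => // y nAy; rewrite leNgt; apply/negP => xy; apply: nAy; apply: rA => /=.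
  exact: lt_trans xy nr.
have [n Pn] := measure_bigcup_inner P e0 mF ndF AF.
exists (F n); split=> //; by rewrite AF; exact: bigcup_sup.
Qed.

(** Sets that are inner regular together with their complements form a sigma-algebra containing the
    open sets; complements have to be included because inner regularity alone is not visibly stable
    under them. *)
Lemma measurable_closed_inner_regular (A : set (borel T)) :
  measurable A -> closed_inner_regular A.
Proof.
pose H := [set A : set (borel T) | measurable A /\
  closed_inner_regular A /\ closed_inner_regular (~` A)].
suff : measurable `<=` H by move=> /[apply] -[_ []].
apply: smallest_sub; last first.
  move=> O oO; split; first exact: open_borel_measurable.
  split; first exact: open_closed_inner_regular.
  move=> e e0; exists (~` O); split=> //; first exact: open_closedC.
  by rewrite setDv measure0 lee_fin ltW.
have HC A' : H A' -> H (~` A').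
  by move=> [mA [rA rCA]]; split; [exact: measurableC|split; rewrite ?setCK].
have H0 : H set0.
  split=> //; split=> e e0.
    by exists set0; split=> //; rewrite ?setDv ?measure0 ?lee_fin ?ltW//; exact: closed0.
  exists setT; rewrite setC0; split=> //.
  by rewrite setDv measure0 lee_fin ltW.
split=> //.
  by move=> A' HA'; rewrite setTD; exact: HC.
move=> B HB; have mB n : measurable (B n : set (borel T)) by case: (HB n).
have mU : measurable (\bigcup_n B n : set (borel T)) by exact: bigcup_measurable.
split=> //; split; last first.
  move=> e e0; rewrite setC_bigcup.
  have en n : 0 < e / (2 ^ n.+1)%:R by rewrite divr_gt0// ltr0n expn_gt0.
  have /choice[F FP] : forall n, exists F, [/\ closed F, F `<=` ~` B n &
      (P ((~` B n : set (borel T)) `\` F) <= (e / (2 ^ n.+1)%:R)%:E)%E].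
    by move=> n; case: (HB n) => _ [_ /(_ _ (en n))].
  exists (\bigcap_n F n); split.
  - by apply: closed_bigI => n _; case: (FP n).
  - by move=> x Fx n _; case: (FP n) => _ + _; apply; exact: Fx.
  - apply: measure_bigcapD_le => //; first exact: ltW.
    + by move=> n; exact: measurableC.
    + by move=> n; apply: closed_borel_measurable; case: (FP n).
    + by move=> n; case: (FP n).
(* A countable union of closed sets need not be closed: half of [e] pays for cutting the union at a
   finite stage, the other half is split further by induction on that stage. *)
move=> e e0; have e2 : 0 < e / 2 by rewrite divr_gt0.
pose U n : set (borel T) := \big[setU/set0]_(i < n) B i.
have mUn n : measurable (U n) by exact: bigsetU_measurable.
have ndU : nondecreasing_seq (fun n => U n.+1).
  by move=> m n mn; apply/subsetPset; exact: subset_bigsetU.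
have [n' Pn] := measure_bigcup_inner P e2 (fun n => mUn n.+1) ndU
  (esym (bigcup_bigsetU_bigcup B)).
move: n'.+1 Pn => {n'}n Pn.
suff [F [cF FU PF]] : exists F, [/\ closed F, F `<=` U n & (P (U n `\` F) <= (e / 2)%:E)%E].
  exists F; split=> //.
    by apply: (subset_trans FU); exact: bigsetU_bigcup.
  have mF := closed_borel_measurable cF.
  apply: (@le_trans _ _ (P ((\bigcup_n B n) `\` U n) + P (U n `\` F))%E).
    apply: (le_trans _ (measureU2 _ _ _)).
    - apply: le_measure; rewrite ?inE.
      + exact: measurableD.
      + by apply: measurableU; exact: measurableD.
      + by move=> x [Bx nFx]; have [Ux|nUx] := pselect (U n x); [right|left].
    - exact: measurableD.
    - exact: measurableD.
  by rewrite [e]splitr EFinD; exact: leeD.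
elim: n (e / 2) e2 {Pn} => [|n IH] r r0.
  exists set0; rewrite /U big_ord0; split=> //; first exact: closed0.
  by rewrite setDv measure0 lee_fin ltW.
have r2 : 0 < r / 2 by rewrite divr_gt0.
have [F [cF FU PF]] := IH _ r2.
have [_ [/(_ _ r2)[G [cG GB PG]] _]] := HB n.
exists (F `|` G); split; first exact: closedU.
  by rewrite /U big_ord_recr/=; exact: setUSS.
have mF := closed_borel_measurable cF; have mG := closed_borel_measurable cG.
apply: (@le_trans _ _ (P (U n `\` F) + P (B n `\` G))%E).
  apply: (le_trans _ (measureU2 _ _ _)).
  - apply: le_measure; rewrite ?inE.
    + by apply: measurableD => //; exact: measurableU.
    + by apply: measurableU; exact: measurableD.
    + rewrite /U big_ord_recr/= => x [[Ux|Bx]] /not_orP[nF nG]; [left|right] => //.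
  - exact: measurableD.
  - exact: measurableD.
by rewrite [r]splitr EFinD; exact: leeD.
Qed.

Hypothesis dK : complete_metric dist.

(** An ultrafilter on this set contains, for each [n], one of finitely many balls of radius 1/(n+1).
    Points of the finite intersections of the selected balls form a Cauchy sequence, and its limit
    is a limit of the ultrafilter. *)
Lemma compact_totally_bounded (c : nat -> T) (k : nat -> nat) : compact
  (\bigcap_n \big[setU/set0]_(j < k n) [set y | dist (c j) y <= n.+1%:R^-1]).
Proof.
set K := \bigcap_n _; rewrite compact_ultra => F FU FK.
have cK : closed K.
  apply: closed_bigI => n _; apply: closed_bigsetU => j _; exact: closed_metric_ball.
have /choice[j Fj] : forall n, exists j, F [set y | dist (c j) y <= n.+1%:R^-1].
  move=> n; have : F (\big[setU/set0]_(j < k n) [set y | dist (c j) y <= n.+1%:R^-1]).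
    by apply: filterS FK => x; exact.
  elim: (k n) => [|m IH]; first by rewrite big_ord0 => /filter_not_empty.
  rewrite big_ord_recr/= => FUm.
  have [/IH//|Fc] := in_ultra_setVsetC (\big[setU/set0]_(j < m) [set y | dist (c j) y <= n.+1%:R^-1]) FU.
  by exists m; apply: filterS (filterI FUm Fc) => x [[]].
pose G n := \big[setI/setT]_(m < n.+1) [set y | dist (c (j m)) y <= m.+1%:R^-1].
have FG n : F (G n).
  by apply: big_rec => [|m A _ FA]; [exact: filterT|exact: filterI].
have /choice[u Gu] : forall n, exists x, G n x by move=> n; exact: filter_ex (FG n).
have GE n m x : G n x -> (m <= n)%N -> dist (c (j m)) x <= m.+1%:R^-1.
  move=> + mn; rewrite /G (bigD1 (Ordinal (mn : (m < n.+1)%N)))//= => -[+ _].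
  by [].
have inv_lt (e : R) : 0 < e -> exists n : nat, n.+1%:R^-1 + n.+1%:R^-1 < e.
  move=> e0; have e2 : 0 < e / 2 by rewrite divr_gt0.
  have [n _ /(_ n (leqnn n)) /= ne] := near_infty_natSinv_lt (PosNum e2).
  by exists n; rewrite [e]splitr; exact: ltrD.
have [l ul] : exists l : T, u @ \oo --> l.
  apply: dK => e /inv_lt[n0 n0e]; exists n0 => m n mn0 nn0.
  apply: (le_lt_trans (dD _ (c (j n0)) _)); apply: le_lt_trans n0e.
  by rewrite (dC (u m)); apply: lerD; exact: GE (Gu _) _.
have Fl : F --> l.
  move=> A /dT[e e0 eA]; have e2 : 0 < e / 2 by rewrite divr_gt0.
  have [n0 n0e] := inv_lt _ e2.
  apply: filterS (Fj n0) => y cy; apply: eA => /=.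
  have : nbhs l [set z | dist l z < e / 2] by apply/dT; exists (e / 2).
  move=> /ul[n1 _ /(_ (maxn n0 n1)) /=]; rewrite leq_maxr => /(_ isT) lu.
  have cu := GE _ _ _ (Gu (maxn n0 n1)) (leq_maxl n0 n1).
  rewrite [e]splitr; apply: (le_lt_trans (dD _ (u (maxn n0 n1)) _)); apply: ltrD => //.
  apply: le_lt_trans n0e; apply: (le_trans (dD _ (c (j n0)) _)); rewrite (dC (u _)).
  exact: lerD.
exists l; split=> //; apply: contrapT => nKl.
have : F (~` K) by apply: Fl; apply: open_nbhs_nbhs; split=> //; rewrite openC.
by move=> /(filterI FK); rewrite setICr => /filter_not_empty.
Qed.

Hypothesis sT : separable T.

(** Ulam's theorem: at scale 1/(n+1), finitely many balls centred on a dense sequence capture all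
    but e/2^(n+1) of the mass, and the intersection over all scales is compact. *)
Lemma compact_tight (e : R) : 0 < e ->
  exists K, [/\ closed K, compact K & (P (~` K) <= e%:E)%E].
Proof.
move=> e0; have [c dc] := separable_dense_seq sT.
pose B n j : set (borel T) := [set y | dist (c j) y <= n.+1%:R^-1].
have cB n j : closed (B n j) by exact: closed_metric_ball.
pose V n k : set (borel T) := \big[setU/set0]_(j < k) B n j.
have cV n k : closed (V n k) by apply: closed_bigsetU => j _; exact: cB.
have mV n k : measurable (V n k) by exact: closed_borel_measurable.
have en n : 0 < e / (2 ^ n.+1)%:R by rewrite divr_gt0// ltr0n expn_gt0.
have /choice[k kP] : forall n, exists k, (P (setT `\` V n k) <= (e / (2 ^ n.+1)%:R)%:E)%E.
  move=> n; have ndV : nondecreasing_seq (fun k => V n k.+1).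
    by move=> m k mk; apply/subsetPset; exact: subset_bigsetU.
  have [|k Pk] := @measure_bigcup_inner _ _ _ P _ setT _ (en n) (fun k => mV n k.+1) ndV.
    rewrite (bigcup_bigsetU_bigcup (B n)); apply/seteqP; split=> // x _.
    have /dT oB : nbhs x [set y | dist x y < n.+1%:R^-1].
      by apply/dT; exists n.+1%:R^-1.
    have [y [xy [j _ cjy]]] : [set y | dist x y < n.+1%:R^-1] `&` range c !=set0.
      apply: dc; first by exists x; rewrite /= d0.
      apply/metric_openP => y /= xy; exists (n.+1%:R^-1 - dist x y); first by rewrite subr_gt0.
      by move=> z /= yz; apply: (le_lt_trans (dD _ y _)); rewrite -ltrBrDl.
    by exists j => //; rewrite /B/= cjy dC ltW.
  by exists k.+1.
exists (\bigcap_n V n (k n)); split.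
- by apply: closed_bigI => n _; exact: cV.
- exact: compact_totally_bounded.
- have -> : ~` (\bigcap_n V n (k n)) =
      (\bigcap_(n in [set: nat]) [set: borel T]) `\` \bigcap_n V n (k n).
    by rewrite bigcap_const ?setTD//; exists 0%N.
  by apply: measure_bigcapD_le => //; exact: ltW.
Qed.

Lemma compact_inner_regular (B : set (borel T)) (e : R) : measurable B -> 0 < e ->
  exists K, [/\ closed K, compact K, K `<=` B & (P (B `\` K) <= e%:E)%E].
Proof.
move=> mB e0; have e2 : 0 < e / 2 by rewrite divr_gt0.
have [F [cF FB PF]] := measurable_closed_inner_regular mB e2.
have [K [clK cK PK]] := compact_tight e2.
have mF := closed_borel_measurable cF; have mK := closed_borel_measurable clK.
exists (K `&` F); split.
- exact: closedI.
- exact: compact_closedI.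
- by move=> x [_ /FB].
apply: (@le_trans _ _ (P (B `\` F) + P (~` K))%E).
  apply: (le_trans _ (measureU2 _ _ _)).
  - apply: le_measure; rewrite ?inE.
    + by apply: measurableD => //; exact: measurableI.
    + by apply: measurableU; [exact: measurableD|exact: measurableC].
    + move=> x [Bx /not_andP[nK|nF]]; [by right|by left].
  - exact: measurableD.
  - exact: measurableC.
by rewrite [e]splitr EFinD; exact: leeD.
Qed.

End polish_regularity.

Lemma polish_compact_inner_regular (R : realType) (T : ptopologicalType)
    (P : probability (borel T) R) (B : set (borel T)) (e : R) :
  polish R T -> measurable B -> 0 < e ->
  exists K, [/\ closed K, compact K, K `<=` B & (P (B `\` K) <= e%:E)%E].
Proof.
by move=> [sT [dist [dM dT dK]]]; exact: (compact_inner_regular dM dT).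
Qed.

(** * Limits of couplings along an ultrafilter *)

Section algebra_extension.
Context (R : realType) (d : measure_display) (T : measurableType d) (alg : set (set T)) (nu : set T -> R).
Hypotheses (alg0 : alg set0) (algU : setU_closed alg) (algC : setC_closed alg).
Hypothesis nu_ge0 : forall A, alg A -> 0 <= nu A.
Hypothesis nuU : forall A B, alg A -> alg B -> A `&` B = set0 ->
  nu (A `|` B) = nu A + nu B.
Hypothesis nu_continuous : forall F : nat -> set T, (forall n, alg (F n)) ->
  (forall m n, (m <= n)%N -> F n `<=` F m) -> \bigcap_n F n = set0 ->
  forall e, 0 < e -> exists n, nu (F n) < e.

Hypothesis measurable_alg : measurable `<=` <<s alg >>.

(** A copy of [T] that carries [alg] as its algebra of sets, kept apart from the sigma-algebra of
    [T]; the closure proofs are arguments so that the structure can be attached. *)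
Definition algebra_type of alg set0 & setU_closed alg & setC_closed alg : Type := T.

Let aT := algebra_type alg0 algU algC.
HB.instance Definition _ := Pointed.on aT.
HB.instance Definition _ := @isAlgebraOfSets.Build default_measure_display
  aT alg alg0 algU algC.

(* The absolute value only matters outside of the algebra. *)
Let premeasure (A : set aT) : \bar R := `|nu A|%:E.

Let premeasureE A : alg A -> premeasure A = (nu A)%:E.
Proof. by move=> aA; rewrite /premeasure ger0_norm ?nu_ge0. Qed.

Let nu0 : nu set0 = 0.
Proof.
have := nuU alg0 alg0 (setI0 _); rewrite setU0 => h.
by apply/eqP; rewrite -(inj_eq (addrI (nu set0))) addr0 -h.
Qed.

Let premeasure0 : premeasure set0 = 0%E.
Proof. by rewrite premeasureE// nu0. Qed.

Let premeasure_ge0 A : (0 <= premeasure A)%E.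
Proof. by rewrite lee_fin. Qed.

Let alg_bigU (F : nat -> set T) n : (forall i, alg (F i)) ->
  alg (\big[setU/set0]_(i < n) F i).
Proof. by move=> aF; apply: big_rec => // i A _; exact: algU. Qed.

Let nu_bigU (F : nat -> set T) n : (forall i, alg (F i)) -> trivIset setT F ->
  nu (\big[setU/set0]_(i < n) F i) = \sum_(i < n) nu (F i).
Proof.
move=> aF tF; elim: n => [|n IH]; first by rewrite !big_ord0 nu0.
rewrite !big_ord_recr/= -IH nuU//; first exact: alg_bigU.
rewrite -subset0 => x []; rewrite -bigcup_mkord => -[i /= ni Fi] Fn.
move/trivIsetP : tF => /(_ i n I I); rewrite (ltn_eqF ni) => /(_ isT).
by move=> F0; have : (F i `&` F n) x by []; rewrite F0.
Qed.

Let algD A B : alg A -> alg B -> alg (A `\` B).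
Proof.
move=> aA aB; rewrite setDE -[A `&` _]setCK setCI setCK.
by apply: algC; apply: algU => //; exact: algC.
Qed.

(** Finite additivity and continuity at the empty set suffice: the remainders of the partial unions
    decrease to the empty set. *)
Let premeasure_sigma_additive : semi_sigma_additive premeasure.
Proof.
move=> F aF tF aUF; set A := \bigcup_n F n.
pose S n := \big[setU/set0]_(i < n) F i.
have aS n : alg (S n) by exact: alg_bigU.
have SA n : S n `<=` A by exact: bigsetU_bigcup.
have nuAS n : nu A = \sum_(i < n) nu (F i) + nu (A `\` S n).
  rewrite -nu_bigU// -nuU//.
  - by rewrite setDUK//; exact: SA.
  - exact: alg_bigU.
  - exact: algD.
  - by rewrite setDIK.
have ndS m n : (m <= n)%N -> A `\` S n `<=` A `\` S m.
  by move=> mn; apply: setDS; exact: subset_bigsetU.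
have cS : \bigcap_n (A `\` S n) = set0.
  rewrite -subset0 => x Sx; have [[k _ Fkx] _] := Sx 0%N I.
  have [_] := Sx k.+1 I; apply; rewrite /S big_ord_recr/=; by right.
rewrite premeasureE//.
under eq_fun do under eq_bigr do rewrite (premeasureE (aF _)).
under eq_fun do rewrite sumEFin big_mkord.
apply: cvg_EFin; first exact: nearW.
apply/cvgrPdist_lt => e e0.
have [n0 n0e] := nu_continuous (fun n => algD aUF (aS n)) ndS cS e0.
exists n0 => // n /= n0n.
rewrite (nuAS n) addrAC subrr add0r ger0_norm; last exact/nu_ge0/algD.
apply: le_lt_trans n0e; have := nuAS n.
have -> : nu (A `\` S n0) = nu (A `\` S n) + nu ((A `\` S n0) `\` (A `\` S n)).
  rewrite -nuU//.
  - by rewrite setDUK//; exact: ndS.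
  - exact: algD.
  - by apply: algD; exact: algD.
  - by rewrite setDIK.
by move=> _; rewrite lerDl; apply: nu_ge0; apply: algD; exact: algD.
Qed.

HB.instance Definition _ := isMeasure.Build _ aT R premeasure
  premeasure0 premeasure_ge0 premeasure_sigma_additive.

(** The Caratheodory extension, a measure on the sigma-algebra generated by [alg]; [measurable_alg]
    carries it back to the sigma-algebra of [T]. *)
Let extension : set T -> \bar R := measure_extension premeasure.

Let extension_sigma_additive : semi_sigma_additive extension.
Proof.
move=> F mF tF mUF.
apply: (@measure_semi_sigma_additive _ _ _ (measure_extension premeasure)) => //.
- by move=> i; exact: measurable_alg (mF i).
- exact: measurable_alg mUF.
Qed.

HB.instance Definition _ := isMeasure.Build _ T R extension
  (@measure0 _ _ _ (measure_extension premeasure))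
  (@measure_ge0 _ _ _ (measure_extension premeasure)) extension_sigma_additive.

Lemma algebra_extension : exists mu : {measure set T -> \bar R},
  forall A, alg A -> mu A = (nu A)%:E.
Proof.
exists extension => A aA.
by rewrite -premeasureE// -[RHS]measurable_mu_extE.
Qed.

End algebra_extension.

(** By compactness of the segment there is a cluster point, and an ultrafilter converges to its
    cluster points. *)
Lemma ultrafilter_cvg (R : realType) (I : Type) (U : set_system I) (f : I -> R)
    (a b : R) : UltraFilter U -> (forall i, a <= f i <= b) -> exists l : R, f @ U --> l.
Proof.
move=> UU fab; have [|p [_ clp]] := @segment_compact R a b (f @ U) _.
  have : U (f @^-1` `[a, b]%classic) by apply: filterE => i /=; rewrite in_itv/= fab.
  exact.
exists p => B pB; have [//|UB] := in_ultra_setVsetC (f @^-1` B) UU.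
by have [x [nBx Bx]] := clp (~` B) B UB pB.
Qed.

(** Otherwise points of the successive finite intersections would cluster inside [K 0], at a point
    of every [K j]. *)
Lemma compact_bigcap0 (T : topologicalType) (K : nat -> set T) :
  (forall n, closed (K n)) -> compact (K 0%N) -> \bigcap_n K n = set0 ->
  exists n, \big[setI/setT]_(j < n.+1) K j = set0.
Proof.
move=> cK K0 KI; apply: contrapT => /forallNP nK.
have /choice[u uK] : forall n, exists x, (\big[setI/setT]_(j < n.+1) K j) x.
  by move=> n; have /eqP/set0P[x] := nK n; exists x.
have uj j n : (j <= n)%N -> K j (u n).
  by move=> jn; have := uK n; rewrite (bigD1 (Ordinal (jn : (j < n.+1)%N)))//= => -[].
have Fj j : (u @ \oo) (K j) by exists j => // n /= jn; exact: uj.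
have [p [_ clp]] := K0 (u @ \oo) _ (Fj 0%N).
suff : (\bigcap_n K n) p by rewrite KI.
by move=> j _; apply: cK => B pB; exact: clp.
Qed.

Section uniform_regularity.
Context (R : realType) (T : ptopologicalType) (I : Type)
  (mu : I -> probability (borel T) R).
Implicit Types A B C : set (borel T).

(** One compact set serves every index, so the bound survives passage to the limit. *)
Definition uniformly_inner_regular A := forall e : R, 0 < e ->
  exists K, [/\ @closed T K, @compact T K, K `<=` A &
    forall i, (mu i (A `\` K) <= e%:E)%E].

(** Including the complement turns these sets into an algebra. *)
Definition uniformly_regular A := [/\ measurable A,
  uniformly_inner_regular A & uniformly_inner_regular (~` A)].

Lemma uniformly_inner_regular_le A B C : measurable A -> measurable B -> measurable C ->
  uniformly_inner_regular A -> uniformly_inner_regular B ->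
  (forall K L, @closed T K -> @compact T K -> @closed T L -> @compact T L ->
    K `<=` A -> L `<=` B -> exists M, [/\ @closed T M, @compact T M, M `<=` C &
     C `\` M `<=` (A `\` K) `|` (B `\` L)]) ->
  uniformly_inner_regular C.
Proof.
move=> mA mB mC rA rB KL e e0; have e2 : 0 < e / 2 by rewrite divr_gt0.
have [K [cK kK KA PK]] := rA _ e2; have [L [cL kL LB PL]] := rB _ e2.
have [M [cM kM MC CM]] := KL K L cK kK cL kL KA LB; exists M; split=> // i.
have [mK mL mM] := And3 (closed_borel_measurable cK) (closed_borel_measurable cL) (closed_borel_measurable cM).
apply: (@le_trans _ _ (mu i (A `\` K) + mu i (B `\` L))%E).
  apply: (le_trans _ (measureU2 _ _ _)); last 2 first.
  - exact: measurableD.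
  - exact: measurableD.
  by apply: le_measure; rewrite ?inE//; [|apply: measurableU]; exact: measurableD.
by rewrite [e]splitr EFinD; exact: leeD.
Qed.

Lemma uniformly_inner_regularU A B : measurable A -> measurable B ->
  uniformly_inner_regular A -> uniformly_inner_regular B ->
  uniformly_inner_regular (A `|` B).
Proof.
move=> mA mB rA rB; apply: (uniformly_inner_regular_le mA mB) => //.
  exact: measurableU.
move=> K L cK kK cL kL KA LB; exists (K `|` L); split.
- exact: closedU.
- exact: compactU.
- exact: setUSS.
- by move=> x [[Ax|Bx]] /not_orP[nK nL]; [left|right].
Qed.

Lemma uniformly_inner_regularI A B : measurable A -> measurable B ->
  uniformly_inner_regular A -> uniformly_inner_regular B ->
  uniformly_inner_regular (A `&` B).
Proof.
move=> mA mB rA rB; apply: (uniformly_inner_regular_le mA mB) => //.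
  exact: measurableI.
move=> K L cK kK cL kL KA LB; exists (K `&` L); split.
- exact: closedI.
- exact: compact_closedI.
- exact: setISS.
- by move=> x [[Ax Bx]] /not_andP[nK|nL]; [left|right].
Qed.

Lemma uniformly_regularC A : uniformly_regular A -> uniformly_regular (~` A).
Proof. by move=> [mA rA rCA]; split; rewrite ?setCK//; exact: measurableC. Qed.

Lemma uniformly_regularU A B :
  uniformly_regular A -> uniformly_regular B -> uniformly_regular (A `|` B).
Proof.
move=> [mA rA rCA] [mB rB rCB]; split; first exact: measurableU.
  exact: uniformly_inner_regularU.
by rewrite setCU; apply: uniformly_inner_regularI => //; exact: measurableC.
Qed.

(* The mass left outside of the compact sets [K j], j <= n, with empty
   intersection bounds the mass of [F n] uniformly in [i]. *)
Lemma uniformly_regular_continuous (F : nat -> set (borel T)) (e : R) :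
  (forall n, uniformly_regular (F n)) -> (forall m n, (m <= n)%N -> F n `<=` F m) ->
  \bigcap_n F n = set0 -> 0 < e -> exists n, forall i, (mu i (F n) <= e%:E)%E.
Proof.
move=> rF ndF F0 e0.
have en n : 0 < e / (2 ^ n.+1)%:R by rewrite divr_gt0// ltr0n expn_gt0.
have mF n : measurable (F n) by case: (rF n).
have /choice[K KP] : forall n, exists K, [/\ @closed T K, @compact T K, K `<=` F n &
    forall i, (mu i (F n `\` K) <= (e / (2 ^ n.+1)%:R)%:E)%E].
  by move=> n; have [_ /(_ _ (en n))] := rF n.
have mK n : measurable (K n : set (borel T)) by apply: closed_borel_measurable; case: (KP n).
(* The compact sets lie in the [F n], whose intersection is empty; hence finitely many of them
   already have empty intersection. *)
have [n Kn] : exists n, \big[setI/setT]_(j < n.+1) K j = set0.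
  apply: compact_bigcap0; [by move=> n; case: (KP n)|by case: (KP 0%N)|].
  by rewrite -subset0 -F0 => x Kx n _; case: (KP n) => _ _ + _; apply; exact: Kx.
exists n => i; apply: (le_trans _ (epsilon_trick0 xpredT (ltW e0))).
apply: (@le_trans _ _ (\sum_(n <oo) mu i (F n `\` K n))%E).
  apply: measure_sigma_subadditive => //; first by move=> k; exact: measurableD.
  move=> x Fx; apply: contrapT => nx.
  suff : (\big[setI/setT]_(j < n.+1) K j) x by rewrite Kn.
  rewrite -bigcap_mkord => j /= jn; apply: contrapT => nK; apply: nx.
  by exists j => //; split=> //; apply: (ndF j n).
by apply: lee_nneseries => k _ *; [exact: measure_ge0|case: (KP k)].
Qed.

Hypothesis borel_regular : @measurable _ (borel T) `<=` <<s uniformly_regular >>.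
Hypothesis regular0 : uniformly_regular set0.

(** Limits exist on every measurable set, but continuity at the empty set is known only on the
    uniformly regular ones. The measure is extended from that algebra, and convergence is claimed
    only there. *)
Lemma ultrafilter_limit_measure (U : set_system I) : UltraFilter U ->
  exists nu : probability (borel T) R, forall A, uniformly_regular A ->
    fine (mu i A) @[i --> U] --> fine (nu A).
Proof.
move=> UU.
have mu01 A i : measurable A -> 0 <= fine (mu i A) <= 1.
  move=> mA; rewrite fine_ge0//= -lee_fin fineK ?fin_num_measure//.
  exact: probability_le1.
have /choice[nu nuP] : forall A : set (borel T), exists l : R, measurable A ->
    fine (mu i A) @[i --> U] --> l.
  move=> A; have [mA|nA] := pselect (measurable A); last by exists 0 => /nA.
  by have [l] := ultrafilter_cvg UU (mu01 A ^~ mA); exists l.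
have mreg A : uniformly_regular A -> measurable A by case.
have nu_ge0 A : uniformly_regular A -> 0 <= nu A.
  move=> /mreg mA; apply: (cvgr_to_ge (nuP _ mA)).
  by apply: nearW => i; case/andP: (mu01 A i mA).
have nuU A B : uniformly_regular A -> uniformly_regular B -> A `&` B = set0 ->
    nu (A `|` B) = nu A + nu B.
  move=> /mreg mA /mreg mB AB; apply: (cvg_unique _ (nuP _ (measurableU _ _ mA mB))) => //.
  rewrite (_ : (fun i => fine (mu i (A `|` B))) = (fun i => fine (mu i A) + fine (mu i B))).
    by apply: cvgD; exact: nuP.
  apply/funext => i; rewrite -fineD ?fin_num_measure//; congr fine.
  exact: measureU.
have nu_cont (F : nat -> set (borel T)) : (forall n, uniformly_regular (F n)) ->
    (forall m n, (m <= n)%N -> F n `<=` F m) -> \bigcap_n F n = set0 ->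
    forall e, 0 < e -> exists n, nu (F n) < e.
  move=> rF ndF F0 e e0; have e2 : 0 < e / 2 by rewrite divr_gt0.
  have [n muF] := uniformly_regular_continuous rF ndF F0 e2; exists n.
  have mF := mreg _ (rF n).
  (* A limit preserves only the weak inequality, whence the margin [e / 2]. *)
  apply: (@le_lt_trans _ _ (e / 2)); last by rewrite ltr_pdivrMr// ltr_pMr// ltr1n.
  apply: (cvgr_to_le (nuP _ mF)); apply: nearW => i.
  by rewrite -lee_fin fineK ?fin_num_measure.
have [m mE] := algebra_extension regular0 uniformly_regularU uniformly_regularC
  nu_ge0 nuU nu_cont borel_regular.
have rT : uniformly_regular setT by rewrite -setC0; exact: uniformly_regularC.
have m1 : m setT = 1%E.
  rewrite mE//; congr (_%:E); apply: (cvg_unique _ (nuP _ (mreg _ rT))) => //.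
  rewrite (_ : (fun i => fine (mu i setT)) = cst 1); first exact: cvg_cst.
  by apply/funext => i; rewrite [X in fine X](_ : _ = 1%E)//; exact: probability_setT.
have [P PE] := ex_probability m1; exists P => A rA.
by rewrite PE (mE _ rA); exact: (nuP _ (mreg _ rA)).
Qed.

End uniform_regularity.

Section limit_of_couplings.
Context (R : realType) (N : nat) (X : 'I_N -> gmSpace R) (I : Type)
  (mu : I -> probability (borel (prod_space X)) R).
Hypothesis muX : forall i, has_marginals X (mu i).

Definition prod_box (B : forall i, set (borel (X i))) : set (borel (prod_space X)) :=
  [set x | forall i, B i (factor i x)].

Lemma boxE B : prod_box B = \big[setI/setT]_(i < N) (factor i @^-1` B i).
Proof.
apply/seteqP; split=> [x Bx|x Bx i].
  by elim/big_rec : (\big[_/_]_(i < N) _) => // i A _ Ax; split=> //; exact: Bx.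
by move: Bx; rewrite (bigD1 i)//= => -[].
Qed.

Lemma measurable_cylinder i (B : set (borel (X i))) :
  measurable B -> measurable (factor i @^-1` B).
Proof.
by move=> mB; rewrite -[X in measurable X]setTI; exact: measurable_factor.
Qed.

Lemma measurable_box B : (forall i, measurable (B i)) -> measurable (prod_box B).
Proof.
move=> mB; rewrite boxE; apply: big_rec => // i A _ mA.
by apply: measurableI => //; exact: measurable_cylinder.
Qed.

Lemma closed_box B : (forall i, @closed (X i) (B i)) -> @closed (prod_space X) (prod_box B).
Proof.
move=> cB; rewrite (_ : prod_box B = \bigcap_i [set x : prod_space X | B i (x i)]); last first.
  by apply/seteqP; split=> x Bx i; [move=> _|]; exact: Bx.
apply: closed_bigI => i _.
apply: (@closed_comp (prod_space X) (X i) (fun x => x i) (B i)) => // x _.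
exact: (@proj_continuous _ (fun i => X i) i).
Qed.

Lemma compact_box B : (forall i, @compact (X i) (B i)) -> @compact (prod_space X) (prod_box B).
Proof. exact: (@tychonoff _ (fun i => X i)). Qed.

(** What the compact box misses is covered by cylinders whose masses are marginal masses, the same
    for every index. Dividing by [N.+1] rather than [N] avoids a zero denominator. *)
Lemma box_uniformly_inner_regular B : (forall i, measurable (B i)) ->
  uniformly_inner_regular mu (prod_box B).
Proof.
move=> mB e e0; have eN : 0 < e / N.+1%:R by rewrite divr_gt0.
have /dchoice[L LP] : forall i, exists K : set (borel (X i)),
    [/\ @closed (X i) K, @compact (X i) K, K `<=` B i &
      (gm_measure (X i) (B i `\` K) <= (e / N.+1%:R)%:E)%E].
  move=> i; have [K KP] := polish_compact_inner_regular (gm_measure (X i))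
    (gm_polish (X i)) (mB i) eN.
  by exists K.
have mL i : measurable (L i) by apply: closed_borel_measurable; case: (LP i).
exists (prod_box L); split.
- by apply: closed_box => i; case: (LP i).
- by apply: compact_box => i; case: (LP i).
- by move=> x Lx i; case: (LP i) => _ _ + _; apply; exact: Lx.
move=> j; pose D i := factor i @^-1` (B i `\` L i).
have mD i : measurable (D i) by apply: measurable_cylinder; exact: measurableD.
apply: (@le_trans _ _ (\sum_(i < N) mu j (D i))%E).
  apply: (@le_trans _ _ (mu j (\big[setU/set0]_(i < N) D i))).
    apply: le_measure; rewrite ?inE.
    - by apply: measurableD; exact: measurable_box.
    - exact: bigsetU_measurable.
    move=> x [Bx /existsNP[i nLx]]; rewrite (bigD1 i)//=; left; split=> //; exact: Bx.
  suff : measurable (\big[setU/set0]_(i < N) D i) /\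
      (mu j (\big[setU/set0]_(i < N) D i) <= \sum_(i < N) mu j (D i))%E by case.
  elim/big_rec2 : _ => [|i y A _ [mA Ay]]; first by rewrite measure0.
  split; first exact: measurableU.
  by apply: (le_trans (measureU2 _ _ _)) => //; exact: leeD.
apply: (@le_trans _ _ (\sum_(i < N) (e / N.+1%:R)%:E)%E).
  apply: lee_sum => i _; case: (LP i) => _ _ _.
  by rewrite -(has_marginalsP (muX j))//; exact: measurableD.
rewrite sumEFin lee_fin sumr_const card_ord -mulrnAl ler_pdivrMr//.
by rewrite -mulr_natr ler_pM2l// ler_nat.
Qed.

Lemma uniformly_regular0 : uniformly_regular mu set0.
Proof.
split=> //; first by move=> e e0; exists set0; split=> //;
  [exact: closed0|exact: compact0|move=> i; rewrite setDv measure0 lee_fin ltW].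
rewrite setC0 (_ : setT = prod_box (fun i => setT)); first exact: box_uniformly_inner_regular.
by apply/seteqP; split.
Qed.

(** Complements of cylinders are cylinders, whereas complements of boxes are not boxes; hence the
    detour from inner regular boxes through cylinders to uniformly regular boxes. *)
Lemma cylinder_uniformly_regular i (B : set (borel (X i))) : measurable B ->
  uniformly_regular mu (factor i @^-1` B).
Proof.
have inner C : measurable C -> uniformly_inner_regular mu (factor i @^-1` C).
  move=> mC; rewrite (_ : _ @^-1` _ = prod_box (dfwith (fun j => [set: borel (X j)]) i C)).
    by apply: box_uniformly_inner_regular => j; case: dfwithP.
  apply/seteqP; split=> [x Cx j|x /(_ i)]; last by rewrite dfwithin.
  by case: dfwithP.
move=> mB; split; [exact: measurable_cylinder|exact: inner|].
by rewrite preimage_setC; apply: inner; exact: measurableC.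
Qed.

Lemma uniformly_regularI (A B : set (borel (prod_space X))) :
  uniformly_regular mu A -> uniformly_regular mu B -> uniformly_regular mu (A `&` B).
Proof.
move=> rA rB; rewrite -[A `&` B]setCK setCI; apply: uniformly_regularC.
by apply: uniformly_regularU; exact: uniformly_regularC.
Qed.

Lemma box_uniformly_regular B : (forall i, measurable (B i)) ->
  uniformly_regular mu (prod_box B).
Proof.
move=> mB; rewrite boxE; apply: big_rec => [|i A _ rA].
  by rewrite -setC0; apply: uniformly_regularC; exact: uniformly_regular0.
by apply: uniformly_regularI => //; exact: cylinder_uniformly_regular.
Qed.

(** Second countability: an open set is the union of those boxes it contains among countably many,
    with centres in dense sequences and radii 1/(k+1). *)
Lemma borel_product_generated :
  @measurable _ (borel (prod_space X)) `<=` <<s uniformly_regular mu >>.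
Proof.
apply: smallest_sub; first exact: smallest_sigma_algebra.
move=> O oO.
have /dchoice[s sP] : forall i, exists s : nat -> X i, dense (range s).
  by move=> i; apply: separable_dense_seq; case: (gm_polish (X i)).
have /dchoice[d dP] : forall i, exists d : X i -> X i -> R,
    [/\ is_metric d, induces_topology d & complete_metric d].
  by move=> i; case: (gm_polish (X i)).
have md i : is_metric (d i) by case: (dP i).
have td i : induces_topology (d i) by case: (dP i).
pose V (nk : {ffun 'I_N -> nat} * nat) := prod_box (fun i : 'I_N =>
  [set y : borel (X i) | d i (s i (nk.1 i)) y < nk.2.+1%:R^-1]).
have oV i x r : @open (X i) [set y : X i | d i x y < r].
  apply/(metric_openP (td i)) => y /= xy; exists (r - d i x y); first by rewrite subr_gt0.
  by move=> z /= yz; case: (md i) => _ _ /(_ x y z) /le_lt_trans; apply; rewrite -ltrBrDl.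
have -> : O = \bigcup_nk (if `[< V nk `<=` O >] then V nk else set0).
  apply/seteqP; split=> [f Of|f [nk _]]; last by case: asboolP => // VO /VO.
  have /(sum_dist_topology md td)[e e0 eO] : nbhs (f : prod_topology (fun i => X i)) O.
    exact: open_nbhs_nbhs.
  (* The half is for passing through the centre of the box, the factor [N.+1] for summing the
     coordinate distances. *)
  have eN : 0 < e / N.+1%:R / 2 by rewrite !divr_gt0.
  have [k _ /(_ k (leqnn k)) /= ke] := near_infty_natSinv_lt (PosNum eN).
  have /dchoice[n nP] : forall i : 'I_N, exists n : nat, d i (f i) (s i n) < k.+1%:R^-1.
    move=> i; have fi : d i (f i) (f i) < k.+1%:R^-1.
      by case: (md i) => /(_ (f i) (f i))[_ ->].
    have [y [fy [n _ ny]]] := sP i _ (ex_intro _ (f i) fi) (oV i (f i) k.+1%:R^-1).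
    by exists n; rewrite ny.
  exists (finfun n, k) => //; case: asboolP => [_ i|[]].
    by rewrite /= ffunE; case: (md i) => _ -> _; exact: nP.
  move=> g Vg; apply: eO; apply: (sum_dist_ball e0) => i.
  have := Vg i; rewrite /= ffunE => sg.
  case: (md i) => _ _ /(_ (f i) (s i (n i)) (g i)) /le_lt_trans; apply.
  by rewrite [ltRHS]splitr; apply: ltrD; apply: lt_trans ke.
apply: (@countable_bigcupT_measurable _
  (g_sigma_algebraType (uniformly_regular mu : set (set (prod_space X))))).
  exact: countableP.
move=> nk; case: ifP => _; last exact: measurable0.
apply: sub_sigma_algebra; apply: box_uniformly_regular => i.
exact: open_borel_measurable.
Qed.

Lemma coupling_compactness (U : set_system I) : UltraFilter U ->
  exists nu : probability (borel (prod_space X)) R, has_marginals X nu /\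
    forall B, (forall i, measurable (B i)) ->
      fine (mu j (prod_box B)) @[j --> U] --> fine (nu (prod_box B)).
Proof.
move=> UU.
have [nu nuP] := ultrafilter_limit_measure borel_product_generated uniformly_regular0 UU.
exists nu; split=> [i B mB|B mB]; last exact/nuP/box_uniformly_regular.
have mcB := measurable_cylinder mB.
rewrite /pushforward -[_ @^-1` _]/(factor i @^-1` B).
rewrite -[LHS]fineK ?fin_num_measure// -[RHS]fineK ?fin_num_measure//; congr (_%:E).
(* Masses of cylinders are constant along the filter, so the limit inherits the marginals. *)
apply: (cvg_unique _ (nuP _ (cylinder_uniformly_regular mB))) => //.
rewrite (_ : (fun j => _) = cst (fine (gm_measure (X i) B))); first exact: cvg_cst.
by apply/funext => j; rewrite -(has_marginalsP (muX j)).
Qed.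

End limit_of_couplings.

(** * Convergence of the iterates *)

(** The maximal coupling: the common part [m] stays on the diagonal, and the excesses [r] and [t],
    of equal total [tau], are coupled as a normalized product. *)
Lemma near_diagonal_coupling (R : realType) (K : finType) (p q : K -> R) :
  (forall k, 0 <= p k) -> (forall k, 0 <= q k) -> \sum_k p k = \sum_k q k ->
  exists w : K -> K -> R, [/\ forall j k, 0 <= w j k,
    forall j, \sum_k w j k = p j, forall k, \sum_j w j k = q k &
    \sum_(jk | jk.1 != jk.2) w jk.1 jk.2 <= \sum_k `|p k - q k|].
Proof.
move=> p0 q0 pq; pose m k := Num.min (p k) (q k).
pose r k := p k - m k; pose t k := q k - m k; pose tau := \sum_k r k.
have r0 k : 0 <= r k by rewrite subr_ge0 /m ge_min lexx.
have t0 k : 0 <= t k by rewrite subr_ge0 /m ge_min lexx orbT.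
have m0 k : 0 <= m k by rewrite /m le_min p0 q0.
have tauE : tau = \sum_k t k by rewrite /tau /r /t !sumrB pq.
have tau0 : 0 <= tau by exact: sumr_ge0.
(* If [tau] is 0, all excesses vanish and the convention x / 0 = 0 is harmless. *)
have rt k : r k * tau / tau = r k.
  have [tau00|/mulfK//] := eqVneq tau 0.
  have /eqP := tau00; rewrite psumr_eq0// => /allP/(_ k (mem_index_enum _))/eqP ->.
  by rewrite !mul0r.
have tt k : tau * t k / tau = t k.
  have [tau00|tn0] := eqVneq tau 0; last by rewrite mulrAC divff// mul1r.
  have /eqP := tau00; rewrite tauE psumr_eq0// => /allP/(_ k (mem_index_enum _))/eqP ->.
  by rewrite mulr0 mul0r.
exists (fun j k => (if j == k then m j else 0) + r j * t k / tau); split.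
- move=> j k; apply: addr_ge0; first by case: ifP.
  by rewrite divr_ge0// mulr_ge0.
- move=> j; rewrite big_split/= -big_mkcond/= (eq_bigl (pred1 j)).
    rewrite big_pred1_eq.
    by rewrite -mulr_suml -mulr_sumr -tauE rt /r addrC subrK.
  by move=> k; rewrite eq_sym.
- move=> k; rewrite big_split/= -big_mkcond/= big_pred1_eq.
  by rewrite -mulr_suml -mulr_suml tt /t addrC subrK.
- apply: (@le_trans _ _ tau); last first.
    apply: ler_sum => k _; rewrite /r /m; case: (leP (p k) (q k)) => h.
      by rewrite subrr.
    exact: ler_norm.
  apply: (@le_trans _ _ (\sum_(jk : K * K) r jk.1 * t jk.2 / tau)).
    rewrite big_mkcond; apply: ler_sum => -[j k] _ /=; case: ifPn => [/negbTE ->|_].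
      by rewrite add0r.
    by rewrite divr_ge0// mulr_ge0.
  rewrite -(pair_big xpredT xpredT (fun j k => r j * t k / tau))/=.
  under eq_bigr do rewrite -mulr_suml -mulr_sumr -tauE rt.
  by [].
Qed.

Section closeness_in_the_limit.
Context (R : realType) (N : nat) (X : 'I_N -> gmSpace R) (I : Type)
  (mu : I -> probability (borel (prod_space X)) R)
  (nu : probability (borel (prod_space X)) R) (U : set_system I).
Hypothesis muX : forall i, has_marginals X (mu i).
Hypothesis nuX : has_marginals X nu.
Hypothesis UF : Filter U.
Hypothesis mu_nu : forall B, (forall i, measurable (B i)) ->
  fine (mu j (prod_box B)) @[j --> U] --> fine (nu (prod_box B)).

Lemma near_limit_coupling (e : R) : 0 < e -> \forall j \near U,
  exists G : probability (borel (prod_space X) * borel (prod_space X))%type R,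
  [/\ is_pushforward G fst (mu j), is_pushforward G snd nu &
   forall i, (knorm G (lift_kernel fst (lift_kernel (@factor _ _ X i) (@gm_gauge R (X i))) \-
      lift_kernel snd (lift_kernel (@factor _ _ X i) (@gm_gauge R (X i))))%R <= e%:E)%E].
Proof.
move=> e0; have e3 : 0 < e / 3 by rewrite divr_gt0.
have /dchoice[t tP] : forall i, exists t :
    {K : finType & ((borel (X i) -> K) * (K * K -> R))%type},
    label_measurable (projT2 t).1 /\
    (knorm (gm_measure (X i)) (@gm_gauge R (X i) \- lift_kernel (projT2 t).1 (projT2 t).2)%R
      <= (e / 3)%:E)%E.
  move=> i; have [K [a [s [ma gs]]]] := step_approximable_L2
    (measurable_gauge (X i)) (knorm_gauge_lty (X i)) e3.
  by exists (existT _ K (a, s)).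
pose K i := projT1 (t i); pose a i : borel (X i) -> K i := (projT2 (t i)).1.
pose s i : K i * K i -> R := (projT2 (t i)).2.
have ma i : label_measurable (a i) by case: (tP i).
have gs i : (knorm (gm_measure (X i)) (@gm_gauge R (X i) \- lift_kernel (a i) (s i))%R
  <= (e / 3)%:E)%E by case: (tP i).
(* All labels are recorded at once: one coupling must serve every [i], and the cells of [b] are
   boxes, where convergence is known. *)
pose L : finType := {dffun forall i : 'I_N, K i}.
pose b (x : borel (prod_space X)) : L := [ffun i => a i (factor i x)].
pose S i (z : L * L) : R := s i (z.1 i, z.2 i).
have bE (k : L) : b @^-1` [set k] = prod_box (fun i => a i @^-1` [set k i]).
  apply/seteqP; split=> [x /= <- i|x xk]; first by rewrite /= ffunE.
  by apply/ffunP => i; rewrite ffunE; exact: xk.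
have mb : label_measurable b.
  by move=> k; rewrite bE; apply: measurable_box => i; exact: ma.
have bS i : lift_kernel (factor i) (lift_kernel (a i) (s i)) = lift_kernel b (S i).
  by apply/funext => z; rewrite /lift_kernel /S/= !ffunE.
have /choice[C CP] : forall i, exists C, forall j k, (S i j - S i k) ^+ 2 <= C.
  by move=> i; exact: label_oscillation_bound.
pose C' := \sum_i `|C i|.
have CC' i j k : (S i j - S i k) ^+ 2 <= C'.
  apply: (le_trans (CP i j k)); apply: (le_trans (ler_norm _)).
  by rewrite /C' (bigD1 i)//= lerDl sumr_ge0.
have C'0 : 0 <= C' by exact: sumr_ge0.
(* Chosen so that twice [C' * delta] is at most the square of [e / 3]; the [+ 1] excludes a zero
   denominator. *)
pose delta := (e / 3) ^+ 2 / (2 * (C' + 1)).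
have C'1 : 0 < C' + 1 by rewrite ltr_wpDl.
have delta0 : 0 < delta by rewrite divr_gt0 ?exprn_gt0// mulr_gt0.
have Cdelta : C' * delta *+ 2 <= (e / 3) ^+ 2.
  rewrite -mulr_natl /delta (_ : 2%:R * _ = (e / 3) ^+ 2 * (C' / (C' + 1))); last first.
    by field; rewrite lt0r_neq0.
  by rewrite ger_pMr ?exprn_gt0// ler_pdivrMr// mul1r lerDl.
pose p j k := fine (mu j (b @^-1` [set k])); pose q k := fine (nu (b @^-1` [set k])).
(* Summed over the cells these differences stay below [delta], which bounds the label mismatch. *)
have pq : \forall j \near U, forall k, `|q k - p j k| < delta / #|L|.+1%:R.
  apply: (@filter_forall _ _ (fun k j => `|q k - p j k| < delta / #|L|.+1%:R)) => k.
  have : p j k @[j --> U] --> q k.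
    by rewrite /p /q bE; apply: mu_nu => i; exact: ma.
  by move/cvgrPdist_lt; apply; rewrite divr_gt0.
apply: filterS pq => j pqj.
have pE k : mu j (b @^-1` [set k]) = (p j k)%:E by rewrite fineK// fin_num_measure//; exact: mb.
have qE k : nu (b @^-1` [set k]) = (q k)%:E by rewrite fineK// fin_num_measure//; exact: mb.
have sum1 (P : probability (borel (prod_space X)) R) (f : L -> R) :
    (forall k, P (b @^-1` [set k]) = (f k)%:E) -> \sum_k f k = 1.
  move=> Pf; apply: EFin_inj; rewrite -sumEFin -(probability_setT P).
  rewrite (measure_label_sum P mb measurableT).
  by apply: eq_bigr => k _; rewrite setTI; exact/esym/Pf.
have [w [w0 wp wq wD]] : exists w : L -> L -> R, [/\ forall j k, 0 <= w j k,
    forall k, \sum_l w k l = p j k, forall k, \sum_l w l k = q k &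
    \sum_(jk | jk.1 != jk.2) w jk.1 jk.2 <= \sum_k `|p j k - q k|].
  apply: near_diagonal_coupling => [k|k|]; [exact: fine_ge0|exact: fine_ge0|].
  by rewrite (sum1 _ _ pE) (sum1 _ _ qE).
have Pw k : mu j (b @^-1` [set k]) = (\sum_l w k l)%:E by rewrite wp pE.
have Qw k : nu (b @^-1` [set k]) = (\sum_l w l k)%:E by rewrite wq qE.
have [G [G1 G2 Gw]] := label_coupling mb mb w0 Pw Qw.
have GD := label_mismatch mb mb Gw.
exists G; split=> // i.
have mg := measurable_gauge (X i); have mi := @measurable_factor _ _ X i.
have mgs := measurable_funB mg (measurable_lift_label (s i) (ma i)).
have gsi := gs i.
have -> : e = e / 3 + e / 3 + e / 3 by lra.
apply: (knorm_label_close mb mb G1 G2 (s := S i) (C := C') (delta := delta)) => //.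
- exact: measurable_lift_kernel.
- exact: measurable_lift_kernel.
- by rewrite -(knorm_lift mi (has_marginalsP (muX j)) mgs) in gsi; rewrite -bS.
- by rewrite -(knorm_lift mi (has_marginalsP nuX) mgs) in gsi; rewrite -bS.
- exact: ltW.
rewrite GD lee_fin (le_trans wD)//.
apply: (@le_trans _ _ (\sum_(k : L) delta / #|L|.+1%:R)).
  by apply: ler_sum => k _; rewrite distrC ltW.
rewrite sumr_const -mulrnAl ler_pdivrMr// -mulr_natr ler_pM2l//.
by rewrite ler_nat.
Qed.

End closeness_in_the_limit.

Lemma knorm_sum (R : realType) (d : measure_display) (E : measurableType d)
    (P : probability E R) n (F : 'I_n -> E * E -> R) :
  (forall i, measurable_fun setT (F i)) ->
  (knorm P (fun z => \sum_i F i z)%R <= \sum_i knorm P (F i))%E.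
Proof.
elim: n F => [|n IH] F mF.
  rewrite big_ord0 (_ : (fun _ => _) = cst 0) ?knorm_cst ?normr0//.
  by apply/funext => z; rewrite big_ord0.
rewrite big_ord_recr/= (_ : (fun _ => _) =
    ((fun z => \sum_(i < n) F (widen_ord (leqnSn n) i) z) \+ F ord_max)%R); last first.
  by apply/funext => z; rewrite big_ord_recr.
apply: (le_trans (knormD P _ _)) => //; first exact: measurable_sum.
by apply: leeD => //; exact: IH.
Qed.

Lemma increasing_extraction (I : nat -> nat -> Prop) :
  (forall l k0, exists2 k, (k0 <= k)%N & I l k) ->
  exists psi : nat -> nat, (forall m n, (m < n)%N -> (psi m < psi n)%N) /\
    forall l, I l (psi l).
Proof.
move=> Iex; have /choice[f fP] : forall lk : nat * nat, exists k, (lk.2 < k)%N /\ I lk.1 k.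
  by move=> [l k0]; have [k kk Ik] := Iex l k0.+1; exists k.
pose psi := fix psi l := if l is l'.+1 then f (l, psi l') else f (0%N, 0%N).
exists psi; split; last by case=> [|l]; [exact: (fP (0%N, 0%N)).2|exact: (fP (l.+1, psi l)).2].
have psiS l : (psi l < psi l.+1)%N by exact: (fP (l.+1, psi l)).1.
move=> k l; elim: l => // l IH; rewrite ltnS leq_eqVlt => /predU1P[->//|/IH kl].
exact: ltn_trans kl (psiS l).
Qed.

Section barycenter_iteration.
Context (R : realType) (N : nat) (X : 'I_N -> gmSpace R) (rho : 'I_N -> R).
Hypothesis Hrho : simplex rho.

Local Notation Omega := (borel (prod_space X)).
Local Notation gauge Y := (@gm_gauge R Y).
Local Notation g i := (lift_kernel (@factor R N X i) (gauge (X i))).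
Local Notation m := (@prod_gauge R N X rho).

Let mg i : measurable_fun setT (g i). Proof. exact: measurable_lift_factor. Qed.
Let mm : measurable_fun setT m. Proof. exact: measurable_prod_gauge. Qed.

(** [m] is a convex combination of the [g i], so the bound [e] passes to it unchanged. *)
Lemma knorm_prod_gauge_le (d : measure_display) (E : measurableType d)
    (P : probability E R) (u v : E -> Omega) (e : R) :
  measurable_fun setT u -> measurable_fun setT v ->
  (forall i, knorm P (lift_kernel u (g i) \- lift_kernel v (g i))%R <= e%:E)%E ->
  (knorm P (lift_kernel u m \- lift_kernel v m)%R <= e%:E)%E.
Proof.
move=> mu mv ge; have [rho0 rho1] := Hrho.
have mD i : measurable_fun setT (lift_kernel u (g i) \- lift_kernel v (g i))%R.
  by apply: measurable_funB; exact: measurable_lift_kernel.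
rewrite (_ : (_ \- _)%R = fun z => \sum_i rho i * (lift_kernel u (g i) \- lift_kernel v (g i)) z); last first.
  apply/funext => z; rewrite /= /lift_kernel /prod_gauge -sumrB.
  by apply: eq_bigr => i _; rewrite mulrBr.
apply: (le_trans (knorm_sum P _)) => [i|]; first exact: measurable_funM.
apply: (@le_trans _ _ (\sum_i (rho i * e)%:E)%E); last by rewrite sumEFin -mulr_suml rho1 mul1r.
apply: lee_sum => i _; have /andP[ri0 _] := rho0 i.
rewrite knormZ// ger0_norm// EFinM; apply: lee_wpmul2l => //; by rewrite lee_fin.
Qed.

(** The data of one step are packed in a single sigma type so that they can be chosen for all steps
    at once. *)
Lemma TB_gluing (y z : GM R) : TB rho X y z ->
  exists t : {Y : gmSpace R & (probability Omega R * probability (borel Y * Omega)%type R)%type},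
  exists muX : has_marginals X (projT2 t).1,
  [/\ y (projT1 t), z (melting_space rho muX),
    is_pushforward (projT2 t).2 fst (gm_measure (projT1 t)),
    is_pushforward (projT2 t).2 snd (projT2 t).1 &
    forall i, knorm (projT2 t).2 (lift_kernel fst (gauge (projT1 t)) \-
      lift_kernel (@factor R N X i \o snd) (gauge (X i)))%R = GW (projT1 t) (X i)].
Proof.
move=> [Y yY [mu [muO ->]]]; have [G [G1 G2 GGW]] := opt_melting_gluing Hrho muO.
exists (existT _ Y (mu, G)), (opt_melting_marginals muO); split=> //.
exact: toGM_mem.
Qed.

Section melting_sequence.
Variables (Y : nat -> gmSpace R) (mu : nat -> probability Omega R).
Variable G : forall n, probability (borel (Y n) * Omega)%type R.
Hypothesis muX : forall n, has_marginals X (mu n).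
Hypothesis YS : forall n, GW (Y n.+1) (melting_space rho (muX n)) = 0%E.
Hypothesis G1 : forall n, is_pushforward (G n) fst (gm_measure (Y n)).
Hypothesis G2 : forall n, is_pushforward (G n) snd (mu n).
Hypothesis GGW : forall n i, knorm (G n) (lift_kernel fst (gauge (Y n)) \-
  lift_kernel (@factor R N X i \o snd) (gauge (X i)))%R = GW (Y n) (X i).

Let gap n := knorm (G n) (lift_kernel fst (gauge (Y n)) \- lift_kernel snd m)%R.

Let gap_fin n : gap n \is a fin_num.
Proof.
by rewrite ge0_fin_numE ?knorm_ge0//; exact: (knorm_melting_lty rho (muX n)).
Qed.

Lemma melting_gap_cvg0 (e : R) : 0 < e -> \forall n \near \oo, (gap n <= e%:E)%E.
Proof.
move=> e0; have : (fun n => fine (gap n) ^+ 2) @ \oo --> (0 : R).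
  apply: (@cvg_gap0 _ (fun n => energy X rho (Y n))).
  - by move=> n; exact: energy_ge0.
  - by move=> n; exact: sqr_ge0.
  (* The next space is only homomorphic to the melting, as representatives are chosen anew at each
     step; the energy does not see the difference. *)
  move=> n; rewrite (_ : energy X rho (Y n.+1) = energy X rho (melting_space rho (muX n))).
    exact: energy_descent.
  by apply: eq_bigr => i _; rewrite (GW_congr_l _ (YS n)).
move=> /cvgrPdist_lt/(_ _ (exprn_gt0 2 e0)); apply: filterS => n.
rewrite sub0r normrN ger0_norm ?sqr_ge0// => /ltW.
rewrite ler_pXn2r ?nnegrE ?fine_ge0 ?knorm_ge0//; last exact: ltW.
by rewrite -lee_fin fineK.
Qed.

Let Z n := melting_space rho (muX n).

Lemma GW_step_le n : (GW (Y n) (Z n) <= gap n)%E.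
Proof. exact: GW_melting_le. Qed.

Section accumulation_point.
Variables (phi : nat -> nat) (U : set_system nat) (nu : probability Omega R).
Hypothesis phi_infty : forall n0, \forall k \near \oo, (n0 <= phi k)%N.
Hypothesis UU : UltraFilter U.
Hypothesis Uoo : (\oo : set_system nat) `<=` U.
Hypothesis nuX : has_marginals X nu.
Hypothesis mu_nu : forall B, (forall i, measurable (B i)) ->
  fine (mu (phi k) (prod_box B)) @[k --> U] --> fine (nu (prod_box B)).

Let Ylim := melting_space rho nuX.

Let UF : Filter U. Proof. exact: filter_filter. Qed.

Let near_coupling (e : R) : 0 < e -> \forall k \near U, (gap (phi k) <= e%:E)%E /\
  exists H : probability (Omega * Omega)%type R,
  [/\ is_pushforward H fst (mu (phi k)), is_pushforward H snd nu,
   forall i, (knorm H (lift_kernel fst (g i) \- lift_kernel snd (g i))%R <= e%:E)%E &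
   (knorm H (lift_kernel fst m \- lift_kernel snd m)%R <= e%:E)%E].
Proof.
move=> e0; apply: filterI.
  apply: Uoo; have [n0 _ n0P] := melting_gap_cvg0 e0.
  by apply: filterS (phi_infty n0) => k /n0P.
have := near_limit_coupling (fun k => muX (phi k)) nuX UF mu_nu e0.
by apply: filterS => k [H [H1 H2 Hg]]; exists H; split=> //; exact: knorm_prod_gauge_le.
Qed.

Lemma GW_accumulation (e : R) : 0 < e -> \forall k \near U, (GW (Z (phi k)) Ylim <= e%:E)%E.
Proof.
move=> /near_coupling; apply: filterS => k [_ [H [H1 H2 _ Hm]]].
by apply: le_trans Hm; exact: (@GW_le _ (Z (phi k)) Ylim).
Qed.

(* In the limit the identity of X_1 * ... * X_N is a gluing whose projections
   are optimal. *)
Lemma projection_optimal i : (knorm nu (m \- g i)%R <= GW Ylim (X i))%E.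
Proof.
(* Five errors: moving [m] and [g i] from [nu] to [mu n], the gap at [n] twice, and the distance
   from [Z n] to the limit. *)
apply/lee_addgt0Pr => e e0; have e5 : 0 < e / 5 by rewrite divr_gt0.
have [k [[gapk [H [H1 H2 Hg Hm]]] Zk]] :=
  filter_ex (@filterI _ U UF _ _ (near_coupling e5) (GW_accumulation e5)).
set n := phi k in gapk H H1 H2 Hg Hm Zk.
have mf := @measurable_fst _ _ Omega Omega.
have ms := @measurable_snd _ _ Omega Omega.
have mmg := measurable_funB mm (mg i).
have [mfm msm] := (measurable_lift_kernel mf mm, measurable_lift_kernel ms mm).
have [mfg msg] := (measurable_lift_kernel mf (mg i), measurable_lift_kernel ms (mg i)).
have step1 : (knorm nu (m \- g i)%R <= (e / 5)%:E + (knorm (mu n) (m \- g i)%R + (e / 5)%:E))%E.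
  rewrite -(knorm_lift ms H2 mmg) -(knorm_lift mf H1 mmg).
  apply: (le_trans (knorm_triangle H msm mfm msg)); apply: leeD; first by rewrite knormBC.
  apply: (le_trans (knorm_triangle H mfm mfg msg)); exact: leeD.
(* The gauge of [Y n] is inserted on the gluing [G n], where its distance to [g i] is exactly
   [GW (Y n) (X i)]. *)
have step2 : (knorm (mu n) (m \- g i)%R <= (e / 5)%:E + GW (Y n) (X i))%E.
  have msn := @measurable_snd _ _ (borel (Y n)) Omega.
  rewrite -(knorm_lift msn (G2 n) mmg) -GGW.
  have mh : measurable_fun setT (lift_kernel (@fst (borel (Y n)) Omega) (gauge (Y n))).
    by apply: measurable_lift_kernel => //; exact: measurable_gauge.
  have mm' := measurable_lift_kernel msn mm; have mg' := measurable_lift_kernel msn (mg i).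
  apply: (le_trans (knorm_triangle (G n) mm' mh mg')); apply: leeD => //.
  by rewrite knormBC.
have step3 : (GW (Y n) (X i) <= (e / 5)%:E + ((e / 5)%:E + GW Ylim (X i)))%E.
  apply: (le_trans (GW_triangle _ (Z n) _)); apply: leeD.
    exact: le_trans (GW_step_le n) gapk.
  by apply: (le_trans (GW_triangle _ Ylim _)); exact: leeD.
apply: (le_trans step1); apply: (@le_trans _ _ ((e / 5)%:E + (((e / 5)%:E +
   ((e / 5)%:E + ((e / 5)%:E + GW Ylim (X i)))) + (e / 5)%:E))%E).
  apply: leeD => //; apply: leeD => //; apply: (le_trans step2); exact: leeD.
rewrite -(fineK (GW_fin_num Ylim (X i))) -!EFinD lee_fin; lra.
Qed.

Lemma accumulation_point_fixed : TB rho X (toGM Ylim) (toGM Ylim).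
Proof.
exists Ylim; first exact: toGM_mem.
have mid : measurable_fun setT (fun x : Omega => x) by exact: measurable_id.
have Pid : is_pushforward nu (fun x : Omega => x) (gm_measure Ylim) by [].
have mfi i : measurable_fun setT (@factor R N X i) by exact: measurable_factor.
have Pf i : is_pushforward nu (@factor R N X i) (gm_measure (X i)) by exact: has_marginalsP.
have /dchoice[pi piP] : forall i, exists p : probability (borel Ylim * borel (X i))%type R,
    is_pushforward nu (fun x : Omega => (x, factor i x)) p.
  by move=> i; apply: ex_pushforward; exact: measurable_fun_pair.
(* The image of [nu] on the diagonal glues the projection couplings and has melting [nu]. *)
have [gam gamP] : exists gam : probability (borel Ylim * Omega)%type R,
    is_pushforward nu (fun x : Omega => (x, x)) gam.
  by apply: ex_pushforward; exact: measurable_fun_pair.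
have nuO : opt_melting Ylim X nu.
  exists pi => [i|].
    split; first exact: (@coupling_pushforward _ Ylim (X i) _ _ _ _ _ Pid (Pf i) _ (piP i)).
    move=> p' cp'; apply: (@le_trans _ _ (GW Ylim (X i))); last first.
      by apply: ereal_inf_lbound; exists p'.
    rewrite (@GWfun_pushforward _ Ylim (X i) _ _ _ _ _ mid (mfi i) _ (piP i)).
    exact: projection_optimal.
  exists gam => [i|].
    apply/(is_pushforward_comp _ _ gamP); last exact: piP.
    apply: measurable_fun_pair => //.
    exact: measurableT_comp (mfi i) measurable_snd.
  by apply/(is_pushforward_comp _ measurable_snd gamP).
(* The two melting spaces differ only in the proof that [nu] has the right marginals. *)
exists nu, nuO; congr (toGM (melting_space rho _)); exact: Prop_irrelevance.
Qed.

End accumulation_point.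
End melting_sequence.
End barycenter_iteration.

Theorem theorem6p3 (R : realType) (N : nat)
    (XX : 'I_N -> GM R) (X : 'I_N -> gmSpace R) (HX : forall i, XX i (X i))
    (rho : 'I_N -> R) (Hrho : simplex rho)
    (YY : nat -> GM R) (HYY : forall n, TB rho X (YY n) (YY n.+1)) :
  forall phi : nat -> nat, (forall m n, (m < n)%N -> (phi m < phi n)%N) ->
  exists psi : nat -> nat, (forall m n, (m < n)%N -> (psi m < psi n)%N) /\
  exists Y : GM R,
    GWdist (YY (phi (psi l))) Y @[l --> \oo] --> 0%E /\ TB rho X Y Y.
Proof.
move=> phi phiS.
have phi_ge k : (k <= phi k)%N.
  by elim: k => // k IH; exact: leq_ltn_trans IH (phiS _ _ (ltnSn k)).
have /choice[t tP] := fun n => TB_gluing Hrho (HYY n).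
have /dchoice[muX tP'] := tP.
pose Y n := projT1 (t n); pose mu n := (projT2 (t n)).1; pose G n := (projT2 (t n)).2.
have YYn n : YY n (Y n) by case: (tP' n).
have YYS n : YY n.+1 (melting_space rho (muX n)) by case: (tP' n).
have YS n : GW (Y n.+1) (melting_space rho (muX n)) = 0%E by exact: GM_mem_GW0 (YYn _) (YYS n).
have G1 n : is_pushforward (G n) fst (gm_measure (Y n)) by case: (tP' n).
have G2 n : is_pushforward (G n) snd (mu n) by case: (tP' n).
have GGW n i := let: And5 _ _ _ _ h := tP' n in h i.
have [U [UU Uoo]] := @ultraFilterLemma _ (\oo : set_system nat) _.
(* [YY n.+1] is the class of the melting formed at step [n], hence the shift by one. *)
pose phi' k := (phi k).-1.
have phi_infty n0 : \forall k \near \oo, (n0 <= phi' k)%N.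
  exists n0.+1 => // k /= n0k; have := leq_trans n0k (phi_ge k).
  by rewrite /phi'; case: (phi k).
have [nu [nuX mu_nu]] := coupling_compactness (fun k => muX (phi' k)) UU.
pose Ylim := melting_space rho nuX.
have GW_acc (e : R) := GW_accumulation Hrho YS G1 G2 GGW phi_infty UU Uoo nuX mu_nu (e := e).
(* [U] contains every cofinite set, so each tolerance 1/(l+1) is met at arbitrarily large indices.
   Taking [k] above [k0] also makes [phi k] positive, so that its predecessor is genuine. *)
have [|psi [psiS psiP]] := @increasing_extraction
  (fun l k => GWdist (YY (phi k)) (toGM Ylim) <= (l.+1%:R^-1)%:E)%E _.
  move=> l k0; have l0 : 0 < l.+1%:R^-1 :> R by rewrite invr_gt0 ltr0n.
  have k0U : U [set k | (k0 < k)%N] by apply: Uoo; exists k0.+1.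
  have [k [k0k kl]] := filter_ex (filterI k0U (GW_acc _ l0)).
  exists k; first exact: ltnW.
  have phik : phi k = (phi' k).+1.
    by rewrite /phi' prednK//; exact: leq_ltn_trans (leq0n k0) (leq_trans k0k (phi_ge k)).
  by rewrite phik (GWdistE (YYS _) (toGM_mem _)).
exists psi; split=> //; exists (toGM Ylim); split; last first.
  exact: (accumulation_point_fixed Hrho YS G1 G2 GGW phi_infty UU Uoo nuX mu_nu).
apply: (@squeeze_cvge _ _ _ _ (cst 0%E) _ (fun l => (l.+1%:R^-1)%:E)).
- by apply: nearW => l; rewrite GW_ge0/=.
- exact: cvg_cst.
- exact: cvge_harmonic.
Qed.
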